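(* Let $X$ and $Y$ be metric spaces. Assume that $A(X)$ satisfies one of the following: (a) $A(X)$ is a sublattice of $C(X)$ that separates points from closed sets and contains the constants, and either (i) $A(X)=A^{\mathrm{loc}}(X)$ or $A(X)=A^{\mathrm{loc}}_b(X)$; or (ii) $X$ is complete and $A(X)=\mathrm{Lip}(X)$ or $\mathrm{Lip}_b(X)$; or (iii) $A(X)=\mathrm{lip}(X)$ or $\mathrm{lip}_b(X)$, where $X$ is complete with metric $d$ such that $d=D^\alpha$ for some metric $D$ on $X$ and some $0<\alpha<1$; (b) $A(X)=C^p(X)$ or $C^p_b(X)$, where $X$ is an open set in a real Banach space $E$ that supports a $C^p$ bump function ($p\in\mathbb{N}\cup\{\infty\}$). Assume that $A(Y)$ likewise satisfies one of these conditions (with $Y$ in place of $X$). If $T:A(X)\to A(Y)$ is a linear order isomorphism, then there is a homeomorphism $h:X\to Y$ such that $Tf=T1_X\cdot(f\circ h^{-1})$ and $T^{-1}g = T^{-1}1_Y\cdot(g\circ h)$ for all $f\in A(X)$ and $g\in A(Y)$.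
   Context: All functions are real-valued; $1_X$ is the constant $1$. A sublattice of $C(X)$ is a subspace closed under pointwise max and min. $A(X)$ separates points from closed sets if for every $x\in X$ and closed $F\not\ni x$ there is $f\in A(X)$ with $f(x)=1$, $f=0$ on $F$. $A^{\mathrm{loc}}(X)$ is the space of real functions $f$ on $X$ such that every $x_0\in X$ has a neighborhood $U$ and some $g\in A(X)$ with $f=g$ on $U$; a subscript $b$ denotes the subspace of bounded functions. $\mathrm{Lip}(X)$ is the space of real functions $f$ on the metric space $(X,d)$ with $\sup_{x\ne y}|f(x)-f(y)|/d(x,y)<\infty$; $\mathrm{lip}(X)$ is the set of $f\in\mathrm{Lip}(X)$ with $\lim_{t\to0}\sup\{|f(x)-f(y)|/t: 0<d(x,y)<t\}=0$. $C^p(X)$ is the space of $p$ times continuously (Fréchet) differentiable real functions on $X$; $E$ supports a $C^p$ bump function if there is $\varphi\in C^p(E)$ with $\varphi(0)\neq0$ and bounded support. A linear bijection $T$ is an order isomorphism if $f\ge 0\iff Tf\ge0$. *)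

(* Defs.v *)
From HB Require Import structures.
From mathcomp Require Import all_boot all_order all_algebra.
From mathcomp Require Import all_classical all_reals all_analysis.
Set Implicit Arguments. Unset Strict Implicit. Unset Printing Implicit Defensive.
Import Order.TTheory GRing.Theory Num.Theory.
Import numFieldNormedType.Exports.
Local Open Scope classical_set_scope.
Local Open Scope ring_scope.

Section Defs.
Variable R : realType.

Section OnMetric.
Variable X : metricType R.
Local Notation d := (@mdist R X).

Definition cst1 : X -> R := fun _ => 1.

Definition bounded_fun (f : X -> R) : Prop := exists M : R, forall x, `|f x| <= M.

Definition bpart (A : set (X -> R)) : set (X -> R) := [set f | A f /\ bounded_fun f].

Definition sublattice_C (A : set (X -> R)) : Prop :=
  [/\ A (fun _ => 0),
      (forall (a : R) f g, A f -> A g -> A (fun x => a * f x + g x)),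
      (forall f g, A f -> A g -> A (fun x => Num.max (f x) (g x))),
      (forall f g, A f -> A g -> A (fun x => Num.min (f x) (g x)))
    & (forall f, A f -> continuous f)].

Definition separates_points_closed (A : set (X -> R)) : Prop :=
  forall (x : X) (F : set X), closed F -> ~ F x ->
    exists f, [/\ A f, f x = 1 & forall y, F y -> f y = 0].

Definition contains_constants (A : set (X -> R)) : Prop :=
  forall c : R, A (fun _ => c).

Definition locA (A : set (X -> R)) : set (X -> R) :=
  [set f | forall x0 : X, exists U : set X,
     nbhs x0 U /\ exists g, A g /\ forall x, U x -> f x = g x].

Definition complete_metric : Prop :=
  forall u : nat -> X,
    (forall e : R, 0 < e -> exists N, forall m n, (N <= m)%N -> (N <= n)%N ->
        d (u m) (u n) < e) ->
    exists l : X, forall e : R, 0 < e -> exists N, forall n, (N <= n)%N -> d (u n) l < e.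

Definition Lip : set (X -> R) :=
  [set f | exists C : R, forall x y, x <> y -> `|f x - f y| / d x y <= C].

Definition lip : set (X -> R) :=
  [set f | Lip f /\ forall e : R, 0 < e -> exists delta : R, 0 < delta /\
     forall t : R, 0 < t -> t < delta ->
       forall x y, 0 < d x y -> d x y < t -> `|f x - f y| / t <= e].

Definition is_metric (D : X -> X -> R) : Prop :=
  [/\ (forall x y, 0 <= D x y), (forall x y, D x y = 0 <-> x = y),
      (forall x y, D x y = D y x) & (forall x y z, D x z <= D x y + D y z)].

End OnMetric.

(* p in N u {oo} is encoded as [option nat], with [None] = oo. *)
Definition le_p (k : nat) (p : option nat) : Prop :=
  match p with Some n => (k <= n)%N | None => True end.

Section Diff.
Variable E : normedModType R.

Definition upd k (v : 'I_k -> E) (i : 'I_k) (u : E) : 'I_k -> E :=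
  fun j => if j == i then u else v j.

Definition multilinear k (M : ('I_k -> E) -> R) : Prop :=
  forall (v : 'I_k -> E) (i : 'I_k) (a : R) (u w : E),
    M (upd v i (a *: u + w)) = a * M (upd v i u) + M (upd v i w).

Definition mlbound k (M : ('I_k -> E) -> R) (c : R) : Prop :=
  forall v : 'I_k -> E, `|M v| <= c * \prod_(i < k) `|v i|.

Definition consv k (h : E) (v : 'I_k -> E) : 'I_k.+1 -> E :=
  fun i => match unlift ord0 i with Some j => v j | None => h end.

(* F is p times continuously Frechet differentiable on the open set U:
   D k x is the k-th Frechet derivative of F at x (a bounded k-linear form),
   D (k+1) x is the Frechet derivative at x of y |-> D k y (in operator norm,
   identifying L(E, L^k(E)) with L^{k+1}(E)), and each D k, k <= p, is
   continuous for the operator norm. *)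
Definition Cp_on (p : option nat) (U : set E) (F : E -> R) : Prop :=
  exists D : forall k : nat, E -> ('I_k -> E) -> R,
  [/\ (forall x, U x -> forall v, D 0%N x v = F x),
      (forall k, le_p k p -> forall x, U x ->
          multilinear (D k x) /\ exists c, mlbound (D k x) c),
      (forall k, le_p k.+1 p -> forall x, U x -> forall e : R, 0 < e ->
          \forall h \near (0 : E),
            mlbound (fun v => D k (x + h) v - D k x v - D k.+1 x (consv h v))
                    (e * `|h|))
    & (forall k, le_p k p -> forall x, U x -> forall e : R, 0 < e ->
          \forall y \near x, mlbound (fun v => D k y v - D k x v) e)].

Definition supports_Cp_bump (p : option nat) : Prop :=
  exists phi : E -> R, [/\ Cp_on p setT phi, phi 0 != 0 &
     exists r : R, forall x, r < `|x| -> phi x = 0].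
End Diff.

Definition admissible (X : metricType R) (A : set (X -> R)) : Prop :=
  ([/\ sublattice_C A, separates_points_closed A & contains_constants A] /\
   [\/ (* (i) *) A = locA A \/ A = bpart (locA A),
       (* (ii) *) @complete_metric X /\ (A = @Lip X \/ A = bpart (@Lip X))
     | (* (iii) *) @complete_metric X /\ (A = @lip X \/ A = bpart (@lip X)) /\
         exists (D : X -> X -> R) (alpha : R),
           [/\ is_metric D, 0 < alpha, alpha < 1 &
               forall x y, mdist x y = D x y `^ alpha]])
  \/
  (* (b): X is (isometric, via iota, to) an open set U of a real Banach space E
     supporting a C^p bump function, and A = C^p(X) or C^p_b(X) *)
  (exists (p : option nat) (E : completeNormedModType R) (U : set E) (iota : X -> E),
     [/\ open U, injective iota /\ range iota = U,
         (forall x y, mdist x y = `|iota x - iota y|),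
         supports_Cp_bump E p &
         (let CpX := [set f : X -> R | exists F : E -> R,
                        (forall x, F (iota x) = f x) /\ Cp_on p U F] in
          A = CpX \/ A = bpart CpX)]).

Definition linear_order_iso (X Y : metricType R) (A : set (X -> R)) (B : set (Y -> R))
    (T : (X -> R) -> (Y -> R)) (S : (Y -> R) -> (X -> R)) : Prop :=
  [/\ (forall f, A f -> B (T f)),
      (forall g, B g -> A (S g)),
      (forall f, A f -> S (T f) = f) /\ (forall g, B g -> T (S g) = g),
      (forall (a : R) f g, A f -> A g ->
          T (fun x => a * f x + g x) = (fun y => a * T f y + T g y))
    & (forall f, A f -> ((forall x, 0 <= f x) <-> (forall y, 0 <= T f y)))].

End Defs.

(* Main.v *)
Require Import Defs.
From HB Require Import structures.
From mathcomp Require Import all_boot all_order all_algebra.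
From mathcomp Require Import all_classical all_reals all_analysis.
From mathcomp Require Import ring lra.
Import Order.TTheory GRing.Theory Num.Theory.
Import numFieldNormedType.Exports.
Local Open Scope classical_set_scope.
Local Open Scope ring_scope.

Set Implicit Arguments.
Unset Strict Implicit.
Unset Printing Implicit Defensive.

(** Say that [y] is localized at [x] when [T f y] depends on the germ of [f] at
    [x] only (the relation [localized x y]).  An order isomorphism preserves
    disjointness of nonnegative functions, and cutting functions off near [x]
    turns [localized x y] into [T f y = T 1 y * f x]; so everything reduces to finding,
    for every [y], some [x] with [localized x y].  If there is none, bumps of [B]
    supported in disjoint annuli that shrink to [y] pull back to functions whose
    supports are disjoint and locally finite in [X].  A member of [A] that is
    [S 1] on infinitely many of these supports and [0] on infinitely many others
    is then sent to a function that takes the values [1] and [0] arbitrarily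
    close to [y], which contradicts continuity.  Such oscillating functions are
    glued from cut-offs when [A] is a local space.  For Lipschitz functions on a
    complete space they are built from distances to a separated subsequence. *)

(** $C^p$ is not closed under max and min, so the argument about [T] uses only the properties
    gathered in [good], and disjointness of functions is expressed through the order alone. Every
    function produced by [cuttable] or [oscillating] lies between [0] and a given member of [A];
    this is what lets the bounded spaces be treated together with the unbounded ones. The
    oscillation is between [0] and [S 1] because [T 1] is not known to be [1], whereas [T (S 1)] is.
    The price is that [S 1] may be unbounded: a Lipschitz function that drops to [0] and climbs back
    to [w = S 1] needs room proportional to the height of [w]. Separation is therefore measured by
    [rho s t + |w s - w t|] and required to be at least a multiple of [w + 1]. For little Lipschitz
    functions the distance [d = D^alpha] cannot serve as [rho], since distance functions of [d] are
    in general not little Lipschitz; the truncation of [D] at [1] can, because [D] is small compared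
    with [D^alpha] at short range. *)

Section GoodSpaces.
Variable R : realType.

Lemma near_gt (X : topologicalType) (f : X -> R) x c :
  {for x, continuous f} -> c < f x -> \forall z \near x, c < f z.
Proof. by move=> fx cf; exact: (cvgr_gt (f x) fx c cf). Qed.

Lemma near_lt (X : topologicalType) (f : X -> R) x c :
  {for x, continuous f} -> f x < c -> \forall z \near x, f z < c.
Proof. by move=> fx cf; exact: (cvgr_lt (f x) fx c cf). Qed.

(** * Requirements on a function space *)

Section Properties.
Variables (X : metricType R) (A : set (X -> R)).

Definition lin_closed := forall a f g, A f -> A g -> A (fun x => a * f x + g x).

(** Takes the place of multiplication by a cut-off: a sublattice need not be closed under products
    and $C^p$ has no minima, but each provides such a [v] in its own way. *)
Definition cuttable := forall f (x : X) (U : set X),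
  A f -> (forall z, 0 <= f z) -> nbhs x U ->
  exists v, [/\ A v, forall z, 0 <= v z <= f z, \forall z \near x, v z = f z
    & forall z, ~ U z -> v z = 0].

(* This is what makes [A] detect points: along a discrete sequence of open sets
   there is a member oscillating between [0] and [w]. *)
Definition oscillating := forall w (O : nat -> set X),
  A w -> (forall z, 0 <= w z) ->
  (forall n, open (O n)) -> (forall n, O n !=set0) ->
  (forall m n, m <> n -> O m `&` O n = set0) ->
  (forall x : X, exists N, \forall z \near x, forall n, (N <= n)%N -> ~ O n z) ->
  exists v, [/\ A v, forall z, 0 <= v z <= w z,
    forall N, exists n (z : X),
      [/\ (N <= n)%N, O n z & \forall t \near z, v t = w t]
    & forall N, exists n (z : X),
      [/\ (N <= n)%N, O n z & \forall t \near z, v t = 0]].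

(** Stands in for the positive and negative parts, which may leave $C^p$. *)
Definition positively_generated := forall f, A f -> exists g h,
  [/\ A g, A h, forall z, 0 <= g z, forall z, 0 <= h z
    & f = (fun x => g x - h x)].

Record good : Prop := Good {
  gd_lin : lin_closed;
  gd_cst : contains_constants A;
  gd_cont : forall f, A f -> continuous f;
  gd_cut : cuttable;
  gd_osc : oscillating;
  gd_diff : positively_generated
}.

End Properties.

Lemma gd_sub (X : metricType R) (A : set (X -> R)) (gA : good A) f g :
  A f -> A g -> A (fun x => f x - g x).
Proof.
move=> Af Ag; have := gd_lin gA (-1) Ag Af.
by congr A; apply/funext => x; rewrite mulN1r addrC.
Qed.

Lemma linear_order_iso_sym (X Y : metricType R) (A : set (X -> R))
    (B : set (Y -> R)) T S (gA : good A) :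
  linear_order_iso A B T S -> linear_order_iso B A S T.
Proof.
move=> [TB SA [ST TS] Tlin Tpos]; split => //.
- move=> a f g Bf Bg.
  have := Tlin a _ _ (SA _ Bf) (SA _ Bg).
  rewrite !TS// => <-; rewrite ST//.
  exact: (gd_lin gA) (SA _ Bf) (SA _ Bg).
- by move=> f Bf; rewrite -{1}(TS _ Bf); apply: iff_sym; apply: Tpos; apply: SA.
Qed.

(** * Order isomorphisms and localization *)

Section Iso.
Variables (X Y : metricType R) (A : set (X -> R)) (B : set (Y -> R)).
Variables (T : (X -> R) -> (Y -> R)) (S : (Y -> R) -> (X -> R)).
Hypotheses (gA : good A) (gB : good B) (TS : linear_order_iso A B T S).

Let TB f : A f -> B (T f). Proof. by case: TS => + _ _ _ _; apply. Qed.
Let SA f : B f -> A (S f). Proof. by case: TS => _ + _ _ _; apply. Qed.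
Let TK f : A f -> S (T f) = f. Proof. by case: TS => _ _ [+ _] _ _; apply. Qed.
Let SK f : B f -> T (S f) = f. Proof. by case: TS => _ _ [_ +] _ _; apply. Qed.
Let T_ge0 f : A f -> (forall x, 0 <= f x) -> forall y, 0 <= T f y.
Proof. by case: TS => _ _ _ _ + Af f0 => /(_ _ Af)[+ _]; apply. Qed.
Let S_ge0 f : B f -> (forall x, 0 <= f x) -> forall y, 0 <= S f y.
Proof.
by case: (linear_order_iso_sym gA TS) => _ _ _ _ + Af f0 => /(_ _ Af)[+ _]; apply.
Qed.

Let T0 y : T (fun=> 0) y = 0.
Proof.
case: TS => _ _ _ + _ => /(_ 1 _ _ (gd_cst gA 0) (gd_cst gA 0)).
under [X in T X = _]eq_fun do rewrite mulr0 addr0.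
by move=> /(congr1 (@^~ y)) /=; lra.
Qed.

Let TZ a f y : A f -> T (fun x => a * f x) y = a * T f y.
Proof.
move=> Af; case: TS => _ _ _ + _ => /(_ a _ _ Af (gd_cst gA 0)).
under [X in T X = _]eq_fun do rewrite addr0.
by move=> ->; rewrite T0 addr0.
Qed.

Let TBf f g y : A f -> A g -> T (fun x => f x - g x) y = T f y - T g y.
Proof.
move=> Af Ag; case: TS => _ _ _ + _ => /(_ (-1) _ _ Ag Af).
under [X in T X = _]eq_fun do rewrite mulN1r addrC.
by move=> ->; rewrite mulN1r addrC.
Qed.

Let T_le f g : A f -> A g -> (forall x, f x <= g x) -> forall y, T f y <= T g y.
Proof.
move=> Af Ag fg y; rewrite -subr_ge0 -TBf//.
by apply: T_ge0 => [|x]; [exact: gd_sub|rewrite subr_ge0].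
Qed.

(** If both functions are positive at [x], half of their minimum at [x], cut off near [x], is a
    nonzero member below both. The right-hand side mentions only the order of [C], so an order
    isomorphism transports it. *)
Lemma order_disjointP (Z : metricType R) (C : set (Z -> R)) (f g : Z -> R) :
  good C -> C f -> C g -> (forall x, 0 <= f x) -> (forall x, 0 <= g x) ->
  (forall x, f x = 0 \/ g x = 0) <->
  (forall h, C h -> (forall x, 0 <= h x) -> (forall x, h x <= f x) ->
     (forall x, h x <= g x) -> forall x, h x = 0).
Proof.
move=> gC Cf Cg f0 g0; split=> [fg h Ch h0 hf hg x|H x].
  apply/eqP; rewrite eq_le h0 andbT.
  by case: (fg x) => <-.
apply: contrapT => /not_orP[/eqP fx0 /eqP gx0].
have {}fx0 : 0 < f x by rewrite lt_def fx0 f0.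
have {}gx0 : 0 < g x by rewrite lt_def gx0 g0.
pose c := Num.min (f x) (g x) / 2.
have m0 : 0 < Num.min (f x) (g x) by rewrite lt_min fx0.
have c0 : 0 < c by rewrite divr_gt0.
have cm : c < Num.min (f x) (g x) by rewrite /c; lra.
move: (cm); rewrite lt_min => /andP[cf cg].
have U1 : \forall z \near x, c < f z by apply: near_gt cf; exact: gd_cont gC _ Cf x.
have U2 : \forall z \near x, c < g z by apply: near_gt cg; exact: gd_cont gC _ Cg x.
have [v [Cv v0 vx vU]] := gd_cut gC (gd_cst gC c) (fun=> ltW c0) (filterI U1 U2).
have vfg z : v z <= f z /\ v z <= g z.
  have [[/ltW a /ltW b]|n] := pselect (c < f z /\ c < g z).
    by have /andP[_ vc] := v0 z; rewrite !(le_trans vc).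
  by rewrite vU.
have := H v Cv (fun z => proj1 (andP (v0 z))) (fun z => (vfg z).1)
  (fun z => (vfg z).2) x.
by rewrite (nbhs_singleton vx) => /eqP; rewrite gt_eqF.
Qed.

Lemma iso_disjoint f g : A f -> A g -> (forall x, 0 <= f x) -> (forall x, 0 <= g x) ->
  (forall x, f x = 0 \/ g x = 0) -> forall y, T f y = 0 \/ T g y = 0.
Proof.
move=> Af Ag f0 g0 fg; apply/(order_disjointP gB); [exact: TB|exact: TB| | | ].
- exact: T_ge0.
- exact: T_ge0.
move=> h Bh h0 hf hg y.
have Sle k : A k -> (forall y, h y <= T k y) -> forall x, S h x <= k x.
  move=> Ak hk x; rewrite -subr_ge0.
  have Ad : A (fun x => k x - S h x) by apply: gd_sub => //; exact: SA.
  case: TS => _ _ _ _ /(_ _ Ad)[_ +]; apply => z.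
  by rewrite TBf//; [rewrite SK// subr_ge0|exact: SA].
move/(order_disjointP gA Af Ag f0 g0)/(_ _ (SA Bh)): fg => Sh0.
rewrite -(SK Bh) (_ : S h = fun=> 0)//; apply/funext; apply: Sh0; last 2 first.
- exact: Sle.
- exact: Sle.
- exact: S_ge0.
Qed.

Definition localized (x : X) (y : Y) := forall f, A f -> (forall z, 0 <= f z) ->
  (\forall z \near x, f z = 0) -> T f y = 0.

(** Cutting a function off near [x] does not change its image at [y] ([same]). Hence [f] can be
    compared from above with the constant [f x + e] after cutting [f], and from below with [f x - e]
    after cutting the constant. *)
Lemma localized_ge0 x y : localized x y -> forall f, A f -> (forall z, 0 <= f z) ->
  T f y = T (fun=> 1) y * f x.
Proof.
move=> xy f Af f0.
have T1 : 0 <= T (fun=> 1) y by apply: T_ge0 => //; exact: gd_cst.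
have Tc c : T (fun=> c) y = c * T (fun=> 1) y.
  rewrite -TZ; last exact: gd_cst.
  by congr (T _ y); apply/funext => z; rewrite mulr1.
have same v g : A v -> A g -> (forall z, 0 <= v z <= g z) ->
    (\forall z \near x, v z = g z) -> T v y = T g y.
  move=> Av Ag vg vx; apply/eqP; rewrite eq_sym -subr_eq0 -TBf//.
  apply/eqP/xy; first exact: gd_sub.
  - by move=> z; rewrite subr_ge0; case/andP: (vg z).
  - by apply: filterS vx => z ->; rewrite subrr.
have up e : 0 < e -> T f y <= (f x + e) * T (fun=> 1) y.
  move=> e0.
  have U : \forall z \near x, f z < f x + e.
    by apply: near_lt; [exact: gd_cont gA _ Af x|rewrite ltrDl].
  have [v [Av v0 vx vU]] := gd_cut gA Af f0 U.
  rewrite -(same v)// -Tc; apply: T_le => //; first exact: gd_cst.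
  move=> z; have [zU|zU] := pselect (f z < f x + e).
    by case/andP: (v0 z) => _ /le_trans; apply; exact: ltW.
  by rewrite vU// addr_ge0// ltW.
have dn e : 0 < e -> e < f x -> (f x - e) * T (fun=> 1) y <= T f y.
  move=> e0 ef.
  have U : \forall z \near x, f x - e < f z.
    by apply: near_gt; [exact: gd_cont gA _ Af x|rewrite gtrDl oppr_lt0].
  have ce : 0 <= f x - e by rewrite subr_ge0 ltW.
  have [v [Av v0 vx vU]] := gd_cut gA (gd_cst gA _) (fun=> ce) U.
  rewrite -Tc -(same v)//; last exact: gd_cst.
  apply: T_le => // z; have [zU|zU] := pselect (f x - e < f z).
    by case/andP: (v0 z) => _ /le_trans; apply; exact: ltW.
  by rewrite vU.
(* [T 1 y] is not yet known to be nonzero, so the tolerance is divided by [T 1 y + 1]. *)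
have T1p : 0 < T (fun=> 1) y + 1 by lra.
apply/eqP; rewrite eq_le mulrC; apply/andP; split.
  apply/ler_addgt0Pr => e e0.
  have /up/le_trans : 0 < e / (T (fun=> 1) y + 1) by rewrite divr_gt0.
  apply; rewrite mulrDl lerD2l mulrAC ler_pdivrMr//.
  by rewrite ler_wpM2l ?ltW//; lra.
apply/ler_addgt0Pr => e e0.
pose d := e / (T (fun=> 1) y + 1).
have d0 : 0 < d by rewrite divr_gt0.
have de : d * T (fun=> 1) y <= e.
  by rewrite /d mulrAC ler_pdivrMr// ler_wpM2l ?ltW//; lra.
(* If [f x <= d] the comparison constant is not positive, and [0 <= T f y] is enough. *)
have [/(dn _ d0)|fd] := ltP d (f x); first lra.
have : f x * T (fun=> 1) y <= d * T (fun=> 1) y by rewrite ler_wpM2r.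
by have := T_ge0 Af f0 y; lra.
Qed.

Lemma localizedE x y : localized x y -> forall f, A f -> T f y = T (fun=> 1) y * f x.
Proof.
move=> xy f /(gd_diff gA)[g [h [Ag Ah g0 h0 ->]]].
by rewrite TBf// (localized_ge0 xy Ag g0) (localized_ge0 xy Ah h0) mulrBr.
Qed.

(** Otherwise all images would vanish at [y], whereas [T (S 1) = 1]. *)
Lemma localized_unit_gt0 x y : localized x y -> 0 < T (fun=> 1) y.
Proof.
move=> xy; rewrite lt_def T_ge0 ?andbT//; last exact: gd_cst.
apply/eqP => T1; have := localizedE xy (SA (gd_cst gB 1)).
by rewrite SK ?T1 ?mul0r; [move/eqP; rewrite oner_eq0|exact: gd_cst].
Qed.

(** * Existence of a point at which [y] is localized *)

Section Existence.
Variable y : Y.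

(** Cut [S b] off to the zero set of [f] near [x]: the result [u] is nonzero, disjoint from [f] and
    below [S b]. So [T u] is nonzero, disjoint from [T f] and below [b], and any point where it is
    positive will do. *)
Lemma bump_away (b : Y -> R) (f : X -> R) (x : X) :
  B b -> (forall z, 0 <= b z) -> 0 < S b x ->
  A f -> (forall z, 0 <= f z) -> (\forall z \near x, f z = 0) ->
  exists2 z, 0 < b z & T f z = 0.
Proof.
move=> Bb b0 bx Af f0 fx.
have [u [Au u0 ux uU]] := gd_cut gA (SA Bb) (S_ge0 Bb b0) fx.
have u_ge0 z : 0 <= u z by case/andP: (u0 z).
have uf z : u z = 0 \/ f z = 0.
  by have [|/uU] := pselect (f z = 0); [right|left].
have Tuf := iso_disjoint Au Af u_ge0 f0 uf.
have [z Tuz] : exists z, T u z <> 0.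
  apply/existsNP => Tu0; move: bx; rewrite -(nbhs_singleton ux).
  suff -> : u = fun=> 0 by rewrite ltxx.
  have /TK <- := Au; have /TK <- := gd_cst gA 0; congr S.
  by apply/funext => z; rewrite Tu0 T0.
exists z; last by case: (Tuf z).
have Tub : T u z <= b z.
  by rewrite -(SK Bb); apply: T_le => // [|t]; [exact: SA|case/andP: (u0 t)].
apply: lt_le_trans Tub; rewrite lt_def T_ge0// andbT.
exact/eqP.
Qed.

Lemma bump_image (b : Y -> R) (z : Y) :
  B b -> (forall z, 0 <= b z) -> b z = 1 -> exists x, 0 < S b x.
Proof.
move=> Bb b0 bz; have [x Sbx] : exists x, S b x <> 0.
  apply/existsNP => Sb0; move: bz.
  rewrite -(SK Bb) (_ : S b = fun=> 0) ?T0; last exact/funext.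
  by apply/eqP; rewrite eq_sym oner_eq0.
by exists x; rewrite lt_def S_ge0// andbT; exact/eqP.
Qed.

Lemma localized_exists_isolated : nbhs y [set y] -> exists x, localized x y.
Proof.
move=> ny.
have [b [Bb b0 by1 bU]] := gd_cut gB (gd_cst gB 1) (fun=> ler01) ny.
have b_ge0 z : 0 <= b z by case/andP: (b0 z).
have [x Sbx] := bump_image Bb b_ge0 (nbhs_singleton by1).
exists x => f Af f0 fx; have [z bz Tfz] := bump_away Bb b_ge0 Sbx Af f0 fx.
suff <- : z = y by [].
by apply: contrapT => /bU bz0; rewrite bz0 ltxx in bz.
Qed.

(** Successive distances to [y] drop by more than a factor [4], so the annuli from half to twice
    these distances do not meet. The crude bound [an] already makes them shrink to [y]. *)
Lemma disjoint_annuli : ~ nbhs y [set y] ->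
  exists (p : nat -> Y) (W : nat -> set Y), [/\ forall n, nbhs (p n) (W n),
    forall m n, m <> n -> W m `&` W n = set0
    & forall V, nbhs y V -> exists N, forall n, (N <= n)%N -> W n `<=` V].
Proof.
move=> ny.
have [q Hq] : {q : R -> Y & forall e, 0 < e -> 0 < mdist y (q e) < e}.
  apply: (@choice _ _ (fun e z => 0 < e -> 0 < mdist y z < e)) => e.
  have [e0|e0] := ltP 0 e; last by exists y.
  apply: contrapT => /forallNP H; apply: ny; apply/nbhs_ballP; exists e => //= z.
  rewrite ballEmdist/= => yze; apply: contrapT => zy; apply: (H z) => _.
  by rewrite yze mdist_gt0 andbT; apply/eqP => zy'; apply: zy.
pose p := fix p n := if n is n'.+1 then q (mdist y (p n') / 4) else q 1.
pose a n := mdist y (p n).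
have a0 n : 0 < a n.
  elim: n => [|n IH]; first by case/andP: (Hq _ (@ltr01 R)).
  by have /Hq/andP[] : 0 < mdist y (p n) / 4 by rewrite divr_gt0.
have aS n : a n.+1 < a n / 4.
  by have /Hq/andP[] : 0 < a n / 4 by rewrite divr_gt0.
have alt m n : (m < n)%N -> a n < a m / 4.
  elim: n => // n IH; rewrite ltnS leq_eqVlt => /predU1P[->//|/IH].
  by have := aS n; have := a0 n; lra.
have an n : a n * n.+1%:R <= 1.
  elim: n => [|n IH]; first by rewrite mulr1; case/andP: (Hq _ (@ltr01 R)) => _ /ltW.
  apply: le_trans (_ : a n / 4 * (2 * n.+1%:R) <= _); last first.
    have : 0 <= a n * n.+1%:R by rewrite mulr_ge0// ltW.
    by rewrite (_ : a n / 4 * _ = a n * n.+1%:R / 2); [lra|field].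
  apply: ler_pM => //; [exact: ltW|exact: ltW|].
  by rewrite -[2 * _]natrM ler_nat mul2n -addnn addSn ltnS leq_addl.
exists p, (fun n => [set z | a n / 2 < mdist y z < 2 * a n]); split.
- move=> n; apply/nbhs_ballP; exists (a n / 2); first by rewrite /= divr_gt0.
  move=> z; rewrite ballEmdist/= => pz.
  have h1 := metric_triangle y (p n) z; have h2 := metric_triangle y z (p n).
  by rewrite (metric_sym z) in h2; have := a0 n; rewrite /a in pz *; lra.
- move=> m n /eqP; rewrite neq_ltn => mn; apply/seteqP; split => // z [/= am aan].
  case/orP: mn => /alt; have := a0 m; have := a0 n; move: am aan; lra.
- move=> V /nbhs_ballP[e /= e0 eV].
  have [N eN] : exists N : nat, 2 / e < N.+1%:R.
    exists (Num.truncn (2 / e)); by rewrite truncnS_gt.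
  exists N => n Nn z /= /andP[_ zn]; apply: eV; rewrite ballEmdist/=.
  apply: lt_le_trans zn _.
  have nN : 2 / e <= n.+1%:R by rewrite (le_trans (ltW eN))// ler_nat.
  rewrite ler_pdivrMr// in nN.
  have : a n * 2 <= a n * (n.+1%:R * e) by rewrite ler_pM2l.
  rewrite mulrA [leLHS]mulrC => /le_trans; apply.
  by rewrite -[leRHS]mul1r ler_pM2r.
Qed.

Lemma localized_exists : exists x, localized x y.
Proof.
have [/localized_exists_isolated//|/disjoint_annuli[p [W [pW Wdisj Wy]]]] :=
  pselect (nbhs y [set y]).
apply: contrapT => /forallNP norel.
have [b Hb] := choice (fun n => gd_cut gB (gd_cst gB 1) (fun=> ler01) (pW n)).
have Bb n : B (b n) by case: (Hb n).
have b0 n z : 0 <= b n z by case: (Hb n) => _ /(_ z)/andP[].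
have bW n z : 0 < b n z -> W n z.
  by move=> bz; apply: contrapT; case: (Hb n) => _ _ _ /[apply] bz0; rewrite bz0 ltxx in bz.
have bp n : b n (p n) = 1 by case: (Hb n) => _ _ /nbhs_singleton.
pose w := S (fun=> 1).
have Aw : A w by apply: SA; exact: gd_cst.
have w0 : forall x, 0 <= w x by apply: S_ge0 => //; exact: gd_cst.
have osc : oscillating A := gd_osc gA.
have [|n|m n mn|x|v [Av v0 vw vz]] := osc w (fun n => [set x | 0 < S (b n) x]) Aw w0.
- move=> n; rewrite openE => x /= Sx.
  by apply: near_gt Sx; exact: gd_cont gA _ (SA (Bb n)) x.
- by have [x Sx] := bump_image (Bb n) (b0 n) (bp n); exists x.
- apply/seteqP; split => // x [/= Sm Sn].
  have bmn z : b m z = 0 \/ b n z = 0.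
    have := b0 m z; rewrite le_eqVlt => /predU1P[<-|/bW Wm]; first by left.
    have := b0 n z; rewrite le_eqVlt => /predU1P[<-|/bW Wn]; first by right.
    by have : (W m `&` W n) z by []; rewrite Wdisj.
  have := (@order_disjointP X A _ _ gA (SA (Bb m)) (SA (Bb n)) (S_ge0 (Bb m) (b0 m))
    (S_ge0 (Bb n) (b0 n))).2 _ x.
  case=> [h Ah h0 hm hn z|e|e]; last 2 first.
  - by rewrite e ltxx in Sm.
  - by rewrite e ltxx in Sn.
  rewrite -(TK Ah) (_ : T h = fun=> 0); last first.
    apply/funext => t; apply/eqP; rewrite eq_le T_ge0// andbT.
    by case: (bmn t) => <-; [rewrite -(SK (Bb m))|rewrite -(SK (Bb n))];
      apply: T_le => //; exact: SA.
  have /TK := gd_cst gA 0; rewrite (_ : T _ = fun=> 0) => [->//|].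
  by apply/funext.
(* Local finiteness at [x]: some [f] vanishes near [x] although [T f] is positive near [y], hence on
   [W n] for large [n]. A point near [x] with [S (b n) > 0] would yield a zero of [T f] inside
   [W n]. *)
- have /existsNP[f /not_implyP[Af /not_implyP[f0 /not_implyP[fx Tf]]]] := norel x.
  have {}Tf : 0 < T f y by rewrite lt_def T_ge0// andbT; exact/eqP.
  have Tfy : \forall z \near y, 0 < T f z.
    by apply: near_gt Tf; exact: gd_cont gB _ (TB Af) y.
  have [N WN] := Wy _ Tfy; exists N.
  have := nbhs_interior fx; apply: filterS => z /= fz n Nn Oz.
  have [t /bW/(WN _ Nn)/= + Tft] := bump_away (Bb n) (b0 n) Oz Af f0 fz.
  by rewrite Tft ltxx.
have v_ge0 z : 0 <= v z by case/andP: (v0 z).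
(* On annuli where [T v] stays within [1/2] of [T v y], it takes the value [1 = T w] (apply
   [bump_away] to [w - v]) and the value [0] (apply it to [v]). *)
have Tvc : {for y, continuous (T v)} by exact: gd_cont gB _ (TB Av) y.
move/cvgrPdist_lt: Tvc => /(_ (1/2)) /(_ ltac:(lra)) /Wy[N WN].
have [n [x [Nn On wv]]] := vw N.
have [m [x' [Nm Om v0x]]] := vz N.
have Ad : A (fun z => w z - v z) by exact: gd_sub.
have d0 z : 0 <= w z - v z by rewrite subr_ge0; case/andP: (v0 z).
have [|t /bW Wt] := bump_away (Bb n) (b0 n) On Ad d0.
  by apply: filterS wv => z ->; rewrite subrr.
rewrite TBf// SK; last exact: gd_cst.
move=> Tvt.
have [t' /bW Wt' Tvt'] := bump_away (Bb m) (b0 m) Om Av v_ge0 v0x.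
have := WN _ Nn _ Wt; have := WN _ Nm _ Wt' => /=.
by rewrite Tvt' (_ : T v t = 1) ?ltr_norml; lra.
Qed.

End Existence.
End Iso.

(** * From localization to the homeomorphism *)

Theorem good_iso_homeo (X Y : metricType R) (A : set (X -> R)) (B : set (Y -> R)) T S :
  good A -> good B -> linear_order_iso A B T S ->
  exists (h : X -> Y) (hinv : Y -> X),
    [/\ cancel h hinv /\ cancel hinv h, continuous h, continuous hinv,
        (forall f, A f -> T f = (fun y => T (fun _ => 1) y * f (hinv y)))
      & (forall g, B g -> S g = (fun x => S (fun _ => 1) x * g (h x)))].
Proof.
move=> gA gB TS; have ST := linear_order_iso_sym gA TS.
have [hinv Hhinv] := choice (localized_exists gA gB TS).
have [h Hh] := choice (localized_exists gB gA ST).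
have [TB SA [TK SK] _ _] := TS.
have sep (Z : metricType R) (C : set (Z -> R)) (gC : good C) x x' :
    (forall f, C f -> f x = f x') -> x = x'.
  move=> H; apply: contrapT => xx'.
  have U : nbhs x (ball x (mdist x x')).
    by apply: nbhsx_ballx; rewrite mdist_gt0; exact/eqP.
  have [v [Cv _ vx vU]] := gd_cut gC (gd_cst gC 1) (fun=> ler01) U.
  have := H _ Cv; rewrite (nbhs_singleton vx) vU; last first.
    by rewrite ballEmdist/= ltxx.
  by move/eqP; rewrite oner_eq0.
(* Stated for arbitrary spaces so as to serve both directions. Applying the two weighted formulas in
   turn to the constant [1] shows that the product of the weights is [1]; thus
   [f x = f (hinv' (h' x))] for all [f], and cut-offs separate points. *)
have canc (X' Y' : metricType R) (A' : set (X' -> R)) (B' : set (Y' -> R)) T' S'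
    (h' : X' -> Y') (hinv' : Y' -> X') (gA' : good A') (gB' : good B')
    (TS' : linear_order_iso A' B' T' S') : (forall y, localized A' T' (hinv' y) y) ->
    (forall x, localized B' S' (h' x) x) -> cancel h' hinv'.
  move=> Hinv H x; have ST' := linear_order_iso_sym gA' TS'.
  apply: (sep _ _ gA') => f Af; have [TB' _ [TK' _] _ _] := TS'.
  have e g : A' g -> g x = S' (fun=> 1) x * (T' (fun=> 1) (h' x) * g (hinv' (h' x))).
    move=> Ag; rewrite -(localizedE gA' TS' (Hinv (h' x)) Ag).
    by rewrite -(localizedE gB' ST' (H x) (TB' _ Ag)) TK'.
  have := e _ (gd_cst gA' 1); rewrite mulr1 => e1.
  by rewrite (e _ Af) mulrA -e1 mul1r.
have cont (X' Y' : metricType R) (A' : set (X' -> R)) (B' : set (Y' -> R)) T' S'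
    (hinv' : Y' -> X') (gA' : good A') (gB' : good B')
    (TS' : linear_order_iso A' B' T' S') : (forall y, localized A' T' (hinv' y) y) ->
    continuous hinv'.
  (* With [v] a cut-off of [1] inside [U], [T' v z > 0] forces [v] to be nonzero at [hinv' z], so
     [hinv' z] lies in [U]; positivity at [y] persists nearby. *)
  move=> Hinv y U nU; have [TB' _ _ _ _] := TS'.
  have [v [Av v0 vx vU]] := gd_cut gA' (gd_cst gA' 1) (fun=> ler01) nU.
  have : 0 < T' v y.
    rewrite (localizedE gA' TS' (Hinv y) Av) (nbhs_singleton vx) mulr1.
    exact: (localized_unit_gt0 gA' gB' TS' (Hinv y)).
  have Tvc : {for y, continuous (T' v)} by exact: gd_cont gB' _ (TB' _ Av) y.
  move/(near_gt Tvc); apply: filterS => z Tvz.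
  apply: contrapT => /vU vz; move: Tvz.
  by rewrite (localizedE gA' TS' (Hinv z) Av) vz mulr0 ltxx.
exists h, hinv; split.
- by split; [exact: canc TS Hhinv Hh|exact: canc ST Hh Hhinv].
- exact: cont ST Hh.
- exact: cont TS Hhinv.
- by move=> f Af; apply/funext => y; rewrite -(localizedE gA TS (Hhinv y) Af).
- by move=> f Af; apply/funext => y; rewrite -(localizedE gB ST (Hh y) Af).
Qed.

End GoodSpaces.

(** * Sublattices that separate points from closed sets *)

Section Lattices.
Variables (R : realType) (X : metricType R) (A : set (X -> R)).

Lemma lattice_lin : sublattice_C A -> lin_closed A.
Proof. by case=> _ lin _ _ _ a f g; exact: lin. Qed.

Lemma lattice_cuttable :
  sublattice_C A -> separates_points_closed A -> cuttable A.
Proof.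
move=> [A0 lin mx mn cont] sep f x U Af f0 nU.
have [|g [Ag gx gU]] := sep x (~` (interior U)) (open_closedC (open_interior U)).
  exact.
(* [K * g] equals [2 * (f x + 1)] at [x], hence exceeds [f] near [x], where the minimum is then
   [f]. *)
pose K := 2 * (f x + 1).
have K0 : 0 < K by have := f0 x; rewrite /K; lra.
have AK : A (fun z => K * g z).
  by have := lin K _ _ Ag A0; congr A; apply/funext => z; rewrite addr0.
exists (fun z => Num.min (f z) (Num.max 0 (K * g z))); split.
- exact/mn/mx.
- by move=> z; rewrite le_min f0 le_max lexx ge_min lexx.
- have fx : \forall z \near x, f z < f x + 1.
    by apply: near_lt; [exact: (cont _ Af)|lra].
  have gx' : \forall z \near x, f x + 1 < K * g z.
    apply: near_gt; first exact: (cont _ AK).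
    by rewrite gx /K; have := f0 x; lra.
  near=> z.
  have h1 : f z < f x + 1 by near: z.
  have h2 : f x + 1 < K * g z by near: z.
  by apply/min_idPl; rewrite le_max (ltW (lt_trans h1 h2)) orbT.
- move=> z zU; rewrite gU ?mulr0 ?maxxx; first by apply/min_idPr.
  by move=> /interior_subset.
Unshelve. all: by end_near. Qed.

Lemma lattice_positively_generated : sublattice_C A -> positively_generated A.
Proof.
move=> [A0 lin mx mn cont] f Af.
have AN : A (fun x => - f x).
  by have := lin (-1) _ _ Af A0; congr A; apply/funext => z; rewrite mulN1r addr0.
exists (fun x => Num.max (f x) 0), (fun x => Num.max (- f x) 0); split.
- exact: mx.
- exact: mx.
- by move=> z; rewrite le_max lexx orbT.
- by move=> z; rewrite le_max lexx orbT.
- apply/funext => z; have [h|h] := leP 0 (f z).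
    by rewrite (_ : Num.max (- f z) 0 = 0) ?subr0//; apply/max_idPr; rewrite oppr_le0.
  rewrite (_ : Num.max (- f z) 0 = - f z) ?opprK ?add0r//.
  by apply/max_idPl; rewrite oppr_ge0 ltW.
Qed.

End Lattices.

(** * Oscillation in local spaces *)

Section LocalSpaces.
Variables (R : realType) (X : metricType R) (A : set (X -> R)).
Hypotheses (Alin : lin_closed A) (Acst : contains_constants A) (Acut : cuttable A).
Hypothesis Aloc : forall v w, locA A v -> A w ->
  (forall z, 0 <= v z <= w z) -> A v.

Let A_sum (f : nat -> X -> R) (P : pred nat) N : (forall n, A (f n)) ->
  A (fun x => \sum_(i < N | P i) f i x).
Proof.
move=> Af; elim: N => [|N IH].
  by under eq_fun do rewrite big_ord0; exact: Acst.
under eq_fun do rewrite big_mkcond big_ord_recr -big_mkcond/= addrC.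
case: (P N); last by under eq_fun do rewrite add0r.
by have := Alin 1 (Af N) IH; congr A; apply/funext => x; rewrite mul1r.
Qed.

(** [w] is cut off inside each [O n] and only the cut-offs of even index are added. The sum is
    finite near each point, and domination by [w] keeps it bounded where [A] requires that. *)
Lemma local_oscillating : oscillating A.
Proof.
move=> w O Aw w0 Oo On0 Odisj Olf.
have [x xO] := choice On0.
have [f Hf] := choice (fun n => Acut Aw w0 (open_nbhs_nbhs (conj (Oo n) (xO n)))).
have Af n : A (f n) by case: (Hf n).
have f0 n z : 0 <= f n z <= w z by case: (Hf n).
have fO n z : ~ O n z -> f n z = 0 by case: (Hf n) => _ _ _; apply.
have sumE N z n : (n < N)%N -> O n z ->
    \sum_(i < N | ~~ odd i) f i z = if odd n then 0 else f n z.
  move=> nN Onz.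
  have other (i : 'I_N) : nat_of_ord i <> n -> f i z = 0.
    by move=> /Odisj ni; apply: fO => Oi; have : (O i `&` O n) z by []; rewrite ni.
  case: ifPn => no.
    rewrite big1// => i io; apply: other => e; move: io; rewrite e no//.
  rewrite (bigD1 (Ordinal nN))//= big1 ?addr0// => i /andP[_ /eqP ni].
  by apply: other => e; apply: ni; apply: val_inj.
have [v Hv] : {v : X -> R & forall z,
    (forall n, O n z -> v z = if odd n then 0 else f n z) /\
    ((forall n, ~ O n z) -> v z = 0)}.
  apply: (@choice _ _ (fun z r => (forall n, O n z -> r = if odd n then 0 else f n z) /\
    ((forall n, ~ O n z) -> r = 0))) => z.
  have [[n nz]|nz] := pselect (exists n, O n z); last first.
    by exists 0; split => // n nOz; exfalso; apply: nz; exists n.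
  exists (if odd n then 0 else f n z); split => [m mz|/(_ _ nz)//].
  have [->//|/eqP/Odisj mn] := eqVneq m n.
  by have : (O m `&` O n) z by []; rewrite mn.
have vin n z : O n z -> v z = if odd n then 0 else f n z by case: (Hv z) => + _; apply.
have vout z : (forall n, ~ O n z) -> v z = 0 by case: (Hv z).
have v0 z : 0 <= v z <= w z.
  have [[n nz]|nz] := pselect (exists n, O n z).
    by rewrite (vin n)//; case: ifP => // _; rewrite lexx w0.
  by rewrite vout ?lexx ?w0// => n nOz; apply: nz; exists n.
exists v; split => //.
- apply: (Aloc _ Aw v0) => z; have [N HN] := Olf z.
  exists [set t | forall n, (N <= n)%N -> ~ O n t]; split => //.
  exists (fun t => \sum_(i < N | ~~ odd i) f i t); split.
    exact: (A_sum (fun n => ~~ odd n) N Af).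
  move=> t /= Ht; have [[n nt]|nt] := pselect (exists n, O n t).
    have nN : (n < N)%N by rewrite ltnNge; apply/negP => /Ht.
    by rewrite (sumE _ _ _ nN nt) (vin _ _ nt).
  rewrite vout; last by move=> n nOz; apply: nt; exists n.
  by rewrite big1// => i _; apply: fO => iOt; apply: nt; exists i.
- move=> N; exists N.*2, (x N.*2); split => //; first by rewrite -addnn leq_addr.
  have [_ _ fw _] := Hf N.*2; have := open_nbhs_nbhs (conj (Oo N.*2) (xO N.*2)).
  by apply: filterS2 fw => t fw /vin ->; rewrite odd_double.
- move=> N; exists N.*2.+1, (x N.*2.+1); split => //.
    by rewrite (@leq_trans N.*2)// -addnn leq_addr.
  have := open_nbhs_nbhs (conj (Oo N.*2.+1) (xO N.*2.+1)).
  by apply: filterS => t /vin ->; rewrite oddS odd_double.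
Qed.

End LocalSpaces.

(** * Extraction of a sequence along a filter *)

Section Ultrafilters.
Variables (G : set_system nat) (S : set nat) (Q : nat -> nat -> Prop).
Hypotheses (GG : ProperFilter G) (Ginf : forall N, G [set n | (N <= n)%N]).
Hypotheses (GS : G S) (GQ : forall n, S n -> G [set m | Q m n]).

(** The conditions [Q m n] imposed by the finitely many earlier choices [n] hold together on one
    member of [G], so the next term can satisfy all of them. *)
Lemma ultrafilter_subsequence : exists z : nat -> nat,
  (forall i, (i <= z i)%N) /\ forall i j, (i < j)%N -> Q (z j) (z i).
Proof.
have step (l : seq nat) : (forall n, n \in l -> S n) ->
    exists m, [/\ S m, (size l <= m)%N & forall n, n \in l -> Q m n].
  move=> lS; have GlQ : G [set m | forall n, n \in l -> Q m n].
    elim: l lS => [|a l IH] lS; first by apply: filterS filterT.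
    have /IH h : forall n, n \in l -> S n by move=> n nl; apply: lS; rewrite inE nl orbT.
    have /GQ : S a by apply: lS; rewrite inE eqxx.
    apply: filterS2 h => m /= h1 h2 n; rewrite inE => /predU1P[->//|]; exact: h1.
  have [m [[Sm lm] Qm]] := filter_ex (filterI (filterI GS (Ginf (size l))) GlQ).
  by exists m.
have [nx Hnx] : {nx : seq nat -> nat & forall l, (forall n, n \in l -> S n) ->
    [/\ S (nx l), (size l <= nx l)%N & forall n, n \in l -> Q (nx l) n]}.
  apply: (@choice _ _ (fun (l : seq nat) m => (forall n, n \in l -> S n) ->
    [/\ S m, (size l <= m)%N & forall n, n \in l -> Q m n])) => l.
  have [/step[m Hm]|nl] := pselect (forall n, n \in l -> S n); first by exists m.
  by exists 0%N.
(* [L k] lists the first [k] terms; the bound by its length gives [i <= z i]. *)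
pose L := fix L k := if k is k'.+1 then nx (L k') :: L k' else [::].
have LS k n : n \in L k -> S n.
  elim: k n => // k IH n /=; rewrite inE => /predU1P[->|/IH//].
  by case: (Hnx (L k) IH).
have sL k : size (L k) = k by elim: k => //= k ->.
exists (fun k => nx (L k)); split=> [i|i j ij].
  by case: (Hnx _ (LS i)); rewrite sL.
have [_ _ ] := Hnx _ (LS j); apply.
by elim: j ij => // j IH; rewrite ltnS leq_eqVlt inE => /predU1P[->|/IH ->];
  rewrite ?eqxx ?orbT.
Qed.

End Ultrafilters.

(** * Lipschitz and little Lipschitz functions on complete spaces *)

Section MetricSpaces.
Variables (R : realType) (X : metricType R).
Implicit Types (A : set (X -> R)) (w v : X -> R).

Lemma inv_natS_lt (e : R) : 0 < e -> exists N : nat, forall n, (N <= n)%N -> n.+1%:R^-1 < e.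
Proof.
move=> e0; exists (Num.truncn e^-1) => n Nn.
rewrite invf_plt ?posrE//; apply: lt_le_trans (truncnS_gt e^-1) _.
by rewrite ler_nat.
Qed.

(* Completeness enters here only: along an ultrafilter, a sequence that leaves
   a neighbourhood of every point is not Cauchy, hence is separated. *)
Lemma ultrafilter_separated (x : nat -> X) (G : set_system nat) :
  complete_metric X -> UltraFilter G -> (forall N, G [set n | (N <= n)%N]) ->
  (forall y : X, exists N, \forall z \near y, forall n, (N <= n)%N -> x n <> z) ->
  exists2 e : R, 0 < e & forall n, G [set m | e <= mdist (x m) (x n)].
Proof.
move=> Xc GU Ginf xlf; apply: contrapT => H.
have Hn k : exists n, G [set m | mdist (x m) (x n) < k.+1%:R^-1].
  apply: contrapT => /forallNP Hk; apply: H; exists k.+1%:R^-1 => // n.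
  have [Ge|] := in_ultra_setVsetC [set m | k.+1%:R^-1 <= mdist (x m) (x n)] GU.
    exact: Ge.
  by apply: contraPP => _ GC; apply: (Hk n); apply: filterS GC => m /= /negP; rewrite -ltNge.
have [n_ Hn_] := choice Hn.
(* The centres [x (n_ k)] form a Cauchy sequence, since two members of [G] always share an index
   [m]. Their limit would have points [x m] with [m] large in every neighbourhood. *)
have [|l Hl] := Xc (x \o n_).
  move=> e e0; have e2 : 0 < e / 2 by rewrite divr_gt0.
  have [N HN] := inv_natS_lt e2; exists N.
  move=> i j Ni Nj; have [m [/= mi mj]] := filter_ex (filterI (Hn_ i) (Hn_ j)).
  apply: le_lt_trans (metric_triangle (x (n_ i)) (x m) (x (n_ j))) _.
  rewrite (metric_sym (x (n_ i)) (x m)) (splitr e).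
  by rewrite ltrD// ?(lt_trans mi)// ?(lt_trans mj)// HN.
have [N /nbhs_ballP[r /= r0 rN]] := xlf l.
have r2 : 0 < r / 2 by rewrite divr_gt0.
have [N1 HN1] := inv_natS_lt r2; have [N2 HN2] := Hl _ r2.
have [m [/= mN mk]] := filter_ex (filterI (Ginf N) (Hn_ (maxn N1 N2))).
apply: (rN (x m) _ m mN) => //; rewrite ballEmdist/= metric_sym.
apply: le_lt_trans (metric_triangle (x m) (x (n_ (maxn N1 N2))) l) _.
rewrite (splitr r) ltrD//; first exact: lt_trans mk (HN1 _ (leq_maxl N1 N2)).
exact: HN2 (leq_maxr N1 N2).
Qed.

Section Gauge.
Variable rho : X -> X -> R.
Hypothesis rho_sym : forall x y, rho x y = rho y x.
Hypothesis rho_ge0 : forall x y, 0 <= rho x y.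
Hypothesis rho_triangle : forall x y z, rho x z <= rho x y + rho y z.
Hypothesis rho_small : forall e : R, 0 < e -> exists2 e', 0 < e' &
  forall x y, rho x y < e' -> mdist x y < e.
Hypothesis mdist_small : forall e : R, 0 < e -> exists2 e', 0 < e' &
  forall x y, mdist x y < e' -> rho x y < e.

Variable A : set (X -> R).
Hypothesis Xc : complete_metric X.
Hypothesis Acont : forall f, A f -> continuous f.
Hypothesis Agauge : forall v w K, A w -> (forall z, 0 <= v z <= w z) ->
  (forall x y, v x - v y <= K * (rho x y + `|w x - w y|)) -> A v.

(** Functions between [0] and [w] that are Lipschitz for the pseudometric [M] belong to [A]. Along a
    subsequence the [M]-distances dominate a multiple of [w + 1]; a multiple of the distance [q] to
    the odd terms, lowered and capped by [w], then vanishes around the odd terms and reaches [w]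
    around the even ones. *)
Lemma gauge_oscillating : oscillating A.
Proof.
move=> w O Aw w0 Oo On0 Odisj Olf.
have [x xO] := choice On0.
pose M s t := rho s t + `|w s - w t|.
have M_ge0 s t : 0 <= M s t by rewrite addr_ge0.
have M_sym s t : M s t = M t s by rewrite /M rho_sym distrC.
have M_tri s t u : M s u <= M s t + M t u.
  rewrite /M; have := rho_triangle s t u; have := ler_distD (w t) (w s) (w u); lra.
have M_near a (e : R) : 0 < e -> \forall t \near a, M t a < e.
  move=> e0; have e2 : 0 < e / 2 by rewrite divr_gt0.
  have [e' e'0 He'] := mdist_small e2.
  have h1 : \forall t \near a, rho t a < e / 2.
    apply/nbhs_ballP; exists e' => // t; rewrite ballEmdist/= => /He'.
    by rewrite rho_sym.
  have h2 : \forall t \near a, `|w t - w a| < e / 2.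
    have wc : {for a, continuous w} by exact: Acont Aw a.
    by move/cvgrPdist_lt: wc => /(_ _ e2); apply: filterS => t; rewrite distrC.
  by apply: filterS2 h1 h2 => t; rewrite /M; lra.
have [G [GU Gsub]] := ultraFilterLemma (eventually_filter).
have Ginf N : G [set n | (N <= n)%N] by apply: Gsub; exists N.
pose Q c i j := c * (w (x i) + 1) <= M (x i) (x j) /\ c * (w (x j) + 1) <= M (x i) (x j).
have [c [c0 [S [GS GQ]]]] : exists c, 0 < c /\ exists S, G S /\
    forall n, S n -> G [set m | Q c m n].
  (* If [w] is bounded along [G], the separation coming from completeness suffices. Otherwise [w]
     itself separates: once [w (x m) > 2 * w (x n) + 1], the gap between the two values is at least
     half of either value plus one. *)
  have [[B GB]|nB] := pselect (exists B, G [set n | w (x n) <= B]).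
    have [|d d0 Hd] := ultrafilter_separated Xc GU Ginf (x := x).
      move=> y; have [N yN] := Olf y; exists N; apply: filterS yN => z Hz n Nn e.
      by apply: (Hz n Nn); rewrite -e.
    have [e e0 He] := rho_small d0.
    have [n0 /= wB] := filter_ex GB.
    have B0 : 0 < B + 1 by have := w0 (x n0); lra.
    exists (e / (B + 1)); split; first by rewrite divr_gt0.
    exists [set n | w (x n) <= B]; split => // n /= wn.
    apply: filterS2 GB (Hd n) => m /= wm dm.
    have em : e <= M (x m) (x n).
      rewrite (@le_trans _ _ (rho (x m) (x n)))// ?lerDl//.
      by rewrite leNgt; apply/negP => /He; rewrite ltNge dm.
    by split; apply: le_trans em; rewrite mulrAC ler_pdivrMr// ler_pM2l// lerD2r.
  exists (1 / 2); split; first by lra.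
  exists setT; split; first exact: filterT.
  move=> n _; have : G [set m | 2 * w (x n) + 1 < w (x m)].
    have [GB|] := in_ultra_setVsetC [set m | w (x m) <= 2 * w (x n) + 1] GU.
      by exfalso; apply: nB; exists (2 * w (x n) + 1).
    by apply: filterS => m /= /negP; rewrite -ltNge.
  apply: filterS => m /= mn; rewrite /Q /M.
  have := rho_ge0 (x m) (x n); have := w0 (x n); have := ler_norm (w (x m) - w (x n)).
  by move=> h1 h2 h3; split; lra.
have GP : ProperFilter G := @ultra_proper _ _ GU.
have [z [zi zQ]] := ultrafilter_subsequence GP Ginf GS GQ.
pose q t := inf (range (fun n => M t (x (z n.*2.+1)))).
have q_inf t : has_inf (range (fun n => M t (x (z n.*2.+1)))).
  split; first by exists (M t (x (z 1))); exists 0%N.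
  by exists 0 => _ [n _ <-].
have q_le t n : q t <= M t (x (z n.*2.+1)).
  by apply: ge_inf; [case: (q_inf t)|exists n].
have q_ge t b : (forall n, b <= M t (x (z n.*2.+1))) -> b <= q t.
  by move=> H; apply: lb_le_inf => [|_ [n _ <-]//]; case: (q_inf t).
have q_lip s t : q s <= q t + M s t.
  rewrite -lerBlDr; apply: q_ge => n; rewrite lerBlDr.
  by have := q_le s n; have := M_tri s t (x (z n.*2.+1)); lra.
(* The offset [c / 2] makes [P] vanish within [M]-distance [c / 2] of the odd terms. At an even term
   [a] the slope [4 / c] still gives at least [4 * (w a + 1) - 2], which leaves a margin above
   [w a]. *)
pose K := 4 / c; have K0 : 0 < K by rewrite divr_gt0.
have Kc : K * c = 4 by rewrite /K mulfVK// gt_eqF.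
pose P t := Num.max 0 (K * (q t - c / 2)).
pose v t := Num.min (w t) (P t).
have P_lip s t : P s <= P t + K * M s t.
  rewrite /P ge_max; apply/andP; split.
    by rewrite addr_ge0// ?le_max ?lexx// mulr_ge0// ltW.
  apply: (@le_trans _ _ (K * (q t - c / 2) + K * M s t)); last first.
    by rewrite lerD2r le_max lexx orbT.
  by rewrite -mulrDr ler_pM2l//; have := q_lip s t; lra.
have v_lip s t : v s - v t <= (1 + K) * (rho s t + `|w s - w t|).
  rewrite -/(M s t) lerBlDl -lerBlDr {2}/v le_min !lerBlDr; apply/andP; split.
    rewrite ge_min; apply/orP; left; rewrite mulrDl mul1r addrA.
    have KM : 0 <= K * M s t by rewrite mulr_ge0// ltW.
    have := rho_ge0 s t; have := ler_norm (w s - w t); move: KM; rewrite {2}/M; lra.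
  rewrite ge_min; apply/orP; right; have := P_lip s t; have := M_ge0 s t; lra.
have v0 t : 0 <= v t <= w t.
  by rewrite /v le_min w0 ge_min lexx /P le_max lexx.
exists v; split => //.
- exact: Agauge Aw v0 v_lip.
- move=> N; exists (z N.*2), (x (z N.*2)); split => //.
    by rewrite (leq_trans _ (zi _))// -addnn leq_addr.
  set a := x _.
  have qa : c * (w a + 1) <= q a.
    (* [Q] bounds [M] below by both values of [w], so it does not matter which of the two terms
       comes later; parity excludes equality. *)
    apply: q_ge => n; case: (ltngtP N.*2 n.*2.+1) => [/zQ[_]|/zQ[]//|/(congr1 odd)].
      by rewrite M_sym.
    by rewrite oddS !odd_double.
  have c8 : 0 < c / 8 by rewrite divr_gt0.
  have wa : \forall t \near a, w t < w a + 1.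
    by apply: near_lt; [exact: Acont Aw a|lra].
  apply: filterS2 (M_near a _ c8) wa => t Mt wt.
  have qt : c * (w a + 1) - c / 8 <= q t.
    by have := q_lip a t; rewrite M_sym; lra.
  apply/min_idPl; rewrite /P le_max; apply/orP; right.
  apply: (@le_trans _ _ (K * (c * (w a + 1) - c / 8 - c / 2))).
    have -> : K * (c * (w a + 1) - c / 8 - c / 2) = K * c * (w a + 1 - 1 / 8 - 1 / 2).
      by field.
    by rewrite Kc; have := w0 a; lra.
  by rewrite ler_pM2l//; lra.
- move=> N; exists (z N.*2.+1), (x (z N.*2.+1)); split => //.
    by rewrite (leq_trans _ (zi _))// (@leq_trans N.*2)// -addnn leq_addr.
  set a := x _.
  have c2 : 0 < c / 2 by rewrite divr_gt0.
  apply: filterS (M_near a _ c2) => t Mt.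
  rewrite /v (_ : P t = 0); first by apply/min_idPr.
  apply/max_idPl; rewrite pmulr_rle0// subr_le0.
  by rewrite (le_trans (q_le t N))// ltW.
Qed.

End Gauge.

Lemma lip_bound (v : X -> R) : Lip v <->
  exists C, forall x y, `|v x - v y| <= C * mdist x y.
Proof.
split=> [[C HC]|[C HC]]; exists C => x y.
  have [->|/eqP xy] := eqVneq x y; first by rewrite subrr normr0 mdistxx mulr0.
  by rewrite -ler_pdivrMr ?HC// mdist_gt0; apply/eqP.
by move=> /eqP xy; rewrite ler_pdivrMr ?HC// mdist_gt0.
Qed.

Lemma sub_le_norm (v : X -> R) (M : X -> X -> R) : (forall x y, M x y = M y x) ->
  (forall x y, v x - v y <= M x y) -> forall x y, `|v x - v y| <= M x y.
Proof.
move=> Ms H x y; rewrite ler_norml H andbT lerNl opprB Ms; exact: H.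
Qed.

Lemma bpart_dominated A v w : bpart A w -> (forall z, 0 <= v z <= w z) -> Defs.bounded_fun v.
Proof.
move=> [_ [M HM]] vw; exists M => x; have /andP[v0 vwx] := vw x.
by rewrite ger0_norm// (le_trans vwx)// (le_trans _ (HM x))// ler_norm.
Qed.

Lemma Lip_gauge v w K : Lip w ->
  (forall x y, v x - v y <= K * (mdist x y + `|w x - w y|)) -> Lip v.
Proof.
move=> /lip_bound[C HC] vK; apply/lip_bound; exists (`|K| * (1 + C)) => x y.
have /= h := sub_le_norm (fun x y => _) vK x y.
have {}h : `|v x - v y| <= K * (mdist x y + `|w x - w y|).
  by apply: h => s t; rewrite metric_sym distrC.
apply: (le_trans h); apply: (le_trans (ler_norm _)); rewrite normrM -mulrA.
apply: ler_wpM2l => //; rewrite ger0_norm ?addr_ge0 ?mdist_ge0//.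
by rewrite mulrDl mul1r lerD2l.
Qed.

Lemma Lip_oscillating A : complete_metric X -> (forall f, A f -> continuous f) ->
  A = @Lip R X \/ A = bpart (@Lip R X) -> oscillating A.
Proof.
move=> Xc Acont HA.
apply: (@gauge_oscillating (@mdist R X)) => //.
- exact: metric_sym.
- by move=> *; exact: mdist_ge0.
- exact: metric_triangle.
- by move=> e e0; exists e.
- by move=> e e0; exists e.
- move=> v w K Aw vw vK; case: HA => eA; rewrite eA in Aw *.
    exact: Lip_gauge Aw vK.
  by split; [exact: Lip_gauge Aw.1 vK|exact: bpart_dominated Aw vw].
Qed.

(** * Little Lipschitz functions for a snowflake metric *)

Section Snowflake.
Variables (D : X -> X -> R) (alpha : R).
Hypotheses (Dm : is_metric D) (alpha0 : 0 < alpha) (alpha1 : alpha < 1).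
Hypothesis dD : forall x y, mdist x y = D x y `^ alpha.

(** Without the truncation [D] would outgrow [D^alpha] at large distances and [rho_le] would
    fail. *)
Let rho x y := Num.min (D x y) 1.

Let D0 x y : 0 <= D x y. Proof. by case: Dm. Qed.

Let Dsym x y : D x y = D y x. Proof. by case: Dm. Qed.

Let rho_ge0 x y : 0 <= rho x y.
Proof. by rewrite le_min D0 ler01. Qed.

Let rho_le x y : rho x y <= mdist x y.
Proof.
rewrite dD /rho; have [D1|D1] := leP (D x y) 1.
  have := D0 x y; rewrite le_eqVlt => /predU1P[<-|Dp]; first exact: powR_ge0.
  by apply: ger1_powR; [rewrite Dp D1|exact: ltW].
by rewrite -(powRr0 (D x y)); apply: ler_powR; exact: ltW.
Qed.

Lemma rho_little (e : R) : 0 < e -> exists2 delta, 0 < delta &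
  forall x y, mdist x y < delta -> rho x y <= e * mdist x y.
Proof.
move=> e0; pose b := 1 - alpha; have b0 : 0 < b by rewrite subr_gt0.
(* This radius means [D < e^(1/b)] with [b = 1 - alpha], and then
   [D = D^b * D^alpha <= e * D^alpha]. *)
exists ((e `^ b^-1) `^ alpha); first by rewrite !powR_gt0.
move=> x y; rewrite dD => Dlt.
have {}Dlt : D x y < e `^ b^-1.
  rewrite ltNge; apply/negP => le; move: Dlt; rewrite ltNge => /negP; apply.
  by rewrite ge0_ler_powR ?nnegrE ?powR_ge0// ltW.
apply: (@le_trans _ _ (D x y)); first by rewrite ge_min lexx.
have := D0 x y; rewrite le_eqVlt => /predU1P[<-|Dp].
  by rewrite mulr_ge0 ?powR_ge0// ltW.
have DE : D x y = D x y `^ b * D x y `^ alpha.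
  by rewrite -powRD ?subrK ?powRr1// ?oner_eq0//; exact: ltW.
rewrite [leLHS]DE ler_wpM2r ?powR_ge0//.
have -> : e = (e `^ b^-1) `^ b by rewrite -powRrM mulVf ?gt_eqF// powRr1// ltW.
by rewrite ge0_ler_powR ?nnegrE ?powR_ge0// ltW.
Qed.

Lemma snowflake_lip_gauge v w K : lip w ->
  (forall x y, v x - v y <= K * (rho x y + `|w x - w y|)) -> lip v.
Proof.
move=> [wL wl] vK.
have KM x y : 0 <= rho x y + `|w x - w y| by rewrite addr_ge0.
have KK : 0 < `|K| + 1 by rewrite ltr_wpDl.
have vK' x y : `|v x - v y| <= (`|K| + 1) * (rho x y + `|w x - w y|).
  apply: (sub_le_norm (M := fun x y => (`|K| + 1) * (rho x y + `|w x - w y|))).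
    by move=> s t; rewrite /rho Dsym distrC.
  move=> s t; apply: le_trans (vK s t) _; rewrite ler_wpM2r//.
  by rewrite (le_trans (ler_norm _))// lerDl.
split.
  apply: (Lip_gauge (K := `|K| + 1) wL) => x y; apply: le_trans (ler_norm _) _.
  by apply: le_trans (vK' x y) _; rewrite ler_wpM2l ?lerD2r// ltW.
move=> e e0; pose e' := e / (2 * (`|K| + 1)).
have e'0 : 0 < e' by rewrite divr_gt0// mulr_gt0.
have [d1 [d10 Hd1]] := wl _ e'0; have [d2 d20 Hd2] := rho_little e'0.
exists (Num.min d1 d2); split; first by rewrite lt_min d10.
move=> t t0; rewrite lt_min => /andP[td1 td2] x y dxy dt.
rewrite ler_pdivrMr//; apply: le_trans (vK' x y) _.
have -> : e = (`|K| + 1) * (e' + e').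
  by rewrite /e'; field; apply/eqP; lra.
rewrite -mulrA ler_pM2l// mulrDl; apply: lerD.
  apply: le_trans (Hd2 x y (lt_trans dt td2)) _.
  by rewrite ler_pM2l// ltW.
by have := Hd1 t t0 td1 x y dxy dt; rewrite ler_pdivrMr.
Qed.

Lemma snowflake_oscillating A : complete_metric X -> (forall f, A f -> continuous f) ->
  A = @lip R X \/ A = bpart (@lip R X) -> oscillating A.
Proof.
move=> Xc Acont HA.
apply: (@gauge_oscillating rho) => //.
- by move=> x y; rewrite /rho Dsym.
- move=> x y z; rewrite /rho; have := rho_ge0 x y; have := rho_ge0 y z.
  have : D x z <= D x y + D y z by case: Dm.
  have := D0 x y; have := D0 y z; rewrite /rho.
  by case: (leP (D x y) 1); case: (leP (D y z) 1); case: (leP (D x z) 1); lra.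
(* The bound [1] excludes the truncated range, where [rho] says nothing about [D]. *)
- move=> e e0; exists (Num.min 1 (e `^ alpha^-1)).
    by rewrite lt_min ltr01 powR_gt0.
  move=> x y; rewrite lt_min /rho; have [D1|D1] := leP (D x y) 1; last first.
    by rewrite ltxx.
  move=> /andP[_ De]; rewrite dD.
  have -> : e = (e `^ alpha^-1) `^ alpha.
    by rewrite -powRrM mulVf ?gt_eqF// powRr1// ltW.
  by apply: gt0_ltr_powR; rewrite ?nnegrE ?powR_ge0.
- by move=> e e0; exists e => // x y; apply: le_lt_trans; exact: rho_le.
- move=> v w K Aw vw vK; case: HA => eA; rewrite eA in Aw *.
    exact: snowflake_lip_gauge Aw vK.
  by split; [exact: snowflake_lip_gauge Aw.1 vK|exact: bpart_dominated Aw vw].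
Qed.

End Snowflake.

End MetricSpaces.

Lemma bpart_locA_dominated (R : realType) (X : metricType R) (A C : set (X -> R)) :
  A = C \/ A = bpart C -> (forall f, locA A f -> C f) ->
  forall v w, locA A v -> A w -> (forall z, 0 <= v z <= w z) -> A v.
Proof.
move=> HA AC v w lv Aw vw; case: HA => eA.
  by rewrite eA; exact: AC.
by rewrite eA; split; [exact: AC|rewrite eA in Aw; exact: bpart_dominated Aw vw].
Qed.

Lemma lattice_good (R : realType) (X : metricType R) (A : set (X -> R)) :
  sublattice_C A -> separates_points_closed A -> contains_constants A ->
  [\/ A = locA A \/ A = bpart (locA A),
      complete_metric X /\ (A = @Lip R X \/ A = bpart (@Lip R X))
    | complete_metric X /\ (A = @lip R X \/ A = bpart (@lip R X)) /\
        exists (D : X -> X -> R) (alpha : R),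
          [/\ is_metric D, 0 < alpha, alpha < 1 &
              forall x y, mdist x y = D x y `^ alpha]] -> good A.
Proof.
move=> lA sA cA H; have [_ _ _ _ contA] := lA; split => //.
- exact: lattice_lin.
- exact: lattice_cuttable.
- case: H => [HA|[Xc HA]|[Xc [HA [D [al [Dm a0 a1 dD]]]]]].
  + apply: local_oscillating => //; [exact: lattice_lin|exact: lattice_cuttable|].
    exact: bpart_locA_dominated HA _.
  + exact: Lip_oscillating.
  + exact: snowflake_oscillating Dm a0 a1 dD _ Xc contA HA.
- exact: lattice_positively_generated.
Qed.

(** * Differentiable fields of multilinear forms *)

Section Forms.
Variables (R : realType) (E : normedModType R).
Implicit Types (M : seq E -> R) (G H : E -> seq E -> R) (U V : set E).

(* A [k]-linear form is a function on sequences of which only the values on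
   those of length [k] matter; products of forms are then taken along masks. *)
Definition mlin k M := forall s1 s2 a u w, (size s1 + (size s2).+1 = k)%N ->
  M (s1 ++ (a *: u + w) :: s2) = a * M (s1 ++ u :: s2) + M (s1 ++ w :: s2).

Definition nprod (s : seq E) := \prod_(x <- s) `|x|.

Definition mbound k M c := forall s, size s = k -> `|M s| <= c * nprod s.

Definition form_cont k G (x : E) := [/\ mlin k (G x), exists c, mbound k (G x) c &
  forall e, 0 < e -> \forall y \near x, mbound k (fun s => G y s - G x s) e].

Definition form_deriv k G G' (x : E) := forall e, 0 < e -> \forall h \near (0 : E),
  mbound k (fun s => G (x + h) s - G x s - G' x (h :: s)) (e * `|h|).

(** Class $C^n$ for a field of [k]-forms. Asking for one derivative at a time, of degree [k.+1],
    instead of a whole tower makes the product and chain rules inductions on [n]. *)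
Fixpoint CC n U k G : Prop := (forall x, U x -> form_cont k G x) /\
  if n is n'.+1 then exists G', (forall x, U x -> form_deriv k G G' x) /\
    CC n' U k.+1 G' else True.

Lemma nprod_ge0 s : 0 <= nprod s.
Proof. by apply: prodr_ge0. Qed.

Lemma nprod_cons h s : nprod (h :: s) = `|h| * nprod s.
Proof. by rewrite /nprod big_cons. Qed.

Lemma nprod_mask b s : size s = size b ->
  nprod s = nprod (mask b s) * nprod (mask (map negb b) s).
Proof.
elim: b s => [[]//|b0 b IH [//|h s] /= [/IH e]].
  by rewrite /nprod big_nil mulr1.
by case: b0; rewrite !nprod_cons e; [rewrite mulrA|rewrite mulrCA].
Qed.

Lemma mbound_le k M c c' : c <= c' -> mbound k M c -> mbound k M c'.
Proof. by move=> cc H s /H /le_trans; apply; rewrite ler_wpM2r// nprod_ge0. Qed.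

Lemma mbound_pos k M c : mbound k M c -> mbound k M `|c|.
Proof. exact/mbound_le/ler_norm. Qed.

Lemma near_add (x : E) (P : set E) : (\forall y \near x, P y) ->
  \forall h \near (0 : E), P (x + h).
Proof.
move=> /nbhs_ballP[e e0 He]; apply/nbhs_ballP; exists e => // h.
rewrite -ball_normE/= sub0r normrN => he; apply: He.
by rewrite -ball_normE/= opprD addNKr normrN.
Qed.

Lemma CC_cont n U k G : CC n U k G -> forall x, U x -> form_cont k G x.
Proof. by case: n => [|n] []. Qed.

Lemma CC_pred n U k G : CC n.+1 U k G -> CC n U k G.
Proof.
elim: n k G => [|n IH] k G [c [G' [dG CG']]]; split=> //.
by exists G'; split => //; apply: IH.
Qed.

Lemma CC_sub n U V k G : V `<=` U -> CC n U k G -> CC n V k G.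
Proof.
move=> VU; elim: n k G => [|n IH] k G /= [c H]; split => //.
- by move=> x /VU; exact: c.
- by move=> x /VU; exact: c.
by case: H => G' [dG CG']; exists G'; split; [move=> x /VU; exact: dG|exact: IH].
Qed.

Section Eq.
Variables (k : nat) (U : set E) (G H : E -> seq E -> R).
Hypothesis Uo : open U.
Hypothesis GH : forall x, U x -> forall s, size s = k -> G x s = H x s.

Lemma form_cont_eq x : U x -> form_cont k G x -> form_cont k H x.
Proof.
move=> Ux [l [c b] ct]; split.
- move=> s1 s2 a u w sk; rewrite -!GH ?l// size_cat//=.
- by exists c => s sk; rewrite -GH ?b.
- move=> e e0; have Un := open_nbhs_nbhs (conj Uo Ux).
  by apply: filterS2 Un (ct e e0) => y Uy By s sk; rewrite -!GH ?By.
Qed.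

Lemma form_deriv_eq G' x : U x -> form_deriv k G G' x -> form_deriv k H G' x.
Proof.
move=> Ux d e e0; have /near_add Un := open_nbhs_nbhs (conj Uo Ux).
by apply: filterS2 Un (d e e0) => h Uh B s sk; rewrite -!GH ?B.
Qed.

Lemma CC_eq n : CC n U k G -> CC n U k H.
Proof.
case: n => [[c _]|n [c [G' [dG CG']]]]; split => //.
- by move=> x Ux; apply: form_cont_eq => //; exact: c.
- by move=> x Ux; apply: form_cont_eq => //; exact: c.
by exists G'; split => // x Ux; apply: form_deriv_eq => //; exact: dG.
Qed.

End Eq.

Lemma mlin_scale k M t h s : mlin k.+1 M -> size s = k ->
  M (t *: h :: s) = t * M (h :: s).
Proof.
move=> l sk; have M0 : M (0 :: s) = 0.
  have := l [::] s 1 0 0 (congr1 S sk); rewrite /= scaler0 addr0 mul1r; lra.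
by have := l [::] s t h 0 (congr1 S sk); rewrite /= addr0 M0 addr0.
Qed.

(** The difference of the two candidates is homogeneous in its first argument and small compared
    with it; evaluating at [t *: h] with [t] small and dividing by [t] makes it vanish. *)
Lemma form_deriv_uniq k G G1 G2 x : mlin k.+1 (G1 x) -> mlin k.+1 (G2 x) ->
  form_deriv k G G1 x -> form_deriv k G G2 x ->
  forall s, size s = k.+1 -> G1 x s = G2 x s.
Proof.
move=> l1 l2 d1 d2 [//|h s] [sk].
pose L h := G1 x (h :: s) - G2 x (h :: s).
have LZ t : L (t *: h) = t * L h.
  by rewrite /L (mlin_scale _ _ l1)// (mlin_scale _ _ l2)// mulrBr.
suff : L h = 0 by move=> /eqP; rewrite subr_eq0 => /eqP.
apply/eqP; rewrite -normr_le0; apply/ler_addgt0Pr => e e0; rewrite add0r.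
pose C := `|h| * nprod s + 1.
have C0 : 0 < C by rewrite ltr_wpDl// mulr_ge0// nprod_ge0.
pose e' := e / (2 * C); have e'0 : 0 < e' by rewrite divr_gt0// mulr_gt0.
have [r /= r0 Hr] := (@nbhs_ballP _ E _ _).1 (filterI (d1 _ e'0) (d2 _ e'0)).
pose t := r / (2 * (`|h| + 1)).
have h1 : 0 < `|h| + 1 by rewrite ltr_wpDl.
have t0 : 0 < t by rewrite divr_gt0// mulr_gt0.
have /Hr[/(_ s sk) B1 /(_ s sk) B2] : ball 0 r (t *: h).
  rewrite -ball_normE/= sub0r normrN normrZ gtr0_norm// /t -mulrAC.
  rewrite ltr_pdivrMr ?mulr_gt0// ltr_pM2l//.
  by have := normr_ge0 h; lra.
have Lt : `|L (t *: h)| <= t * e.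
  have -> : L (t *: h) = (G (x + t *: h) s - G x s - G2 x (t *: h :: s)) -
    (G (x + t *: h) s - G x s - G1 x (t *: h :: s)) by rewrite /L; ring.
  apply: le_trans (ler_normB _ _) _; apply: le_trans (lerD B2 B1) _.
  rewrite normrZ gtr0_norm// (_ : _ + _ = t * (e / C * (`|h| * nprod s))).
    rewrite ler_pM2l// mulrAC ler_pdivrMr// ler_pM2l// /C; lra.
  by rewrite /e'; field; apply/eqP; lra.
by move: Lt; rewrite LZ normrM gtr0_norm// ler_pM2l.
Qed.

(** The derivatives are chosen independently around each point. By uniqueness they agree on
    overlaps, so the diagonal choice [(VG x).2 x] coincides locally with a single one of them. *)
Lemma CC_glue n U k G :
  (forall x, U x -> exists V, [/\ open V, V `<=` U, V x & CC n V k G]) -> CC n U k G.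
Proof.
elim: n k G => [|n IH] k G HU; split=> //.
- by move=> x /HU[V [_ _ Vx /CC_cont]]; apply.
- by move=> x /HU[V [_ _ Vx /CC_cont]]; apply.
have [VG HVG] : {VG : E -> set E * (E -> seq E -> R) & forall x, U x ->
    [/\ open (VG x).1, (VG x).1 `<=` U, (VG x).1 x
      & (forall y, (VG x).1 y -> form_deriv k G (VG x).2 y) /\
        CC n (VG x).1 k.+1 (VG x).2]}.
  apply: (@choice _ _ (fun x (VG : set E * (E -> seq E -> R)) => U x ->
    [/\ open VG.1, VG.1 `<=` U, VG.1 x
      & (forall y, VG.1 y -> form_deriv k G VG.2 y) /\ CC n VG.1 k.+1 VG.2])) => x.
  have [/HU[V [Vo VU Vx [_ [G' [dG CG']]]]]|nU] := pselect (U x).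
    by exists (V, G').
  by exists (set0, G).
exists (fun x => (VG x).2 x); split=> [x /HVG[_ _ Vx [d _]]|]; first exact: d.
apply: IH => x Ux; have [Vo VU Vx [d C]] := HVG x Ux.
exists (VG x).1; split => //.
apply: (CC_eq (G := (VG x).2) Vo _ C) => y Vy s sk.
have [_ _ Vyy [dy Cy]] := HVG y (VU y Vy).
have [ly _ _] := CC_cont Cy Vyy; have [lx _ _] := CC_cont C Vy.
by apply: (form_deriv_uniq lx ly (d y Vy) (dy y Vyy)).
Qed.

End Forms.

(** * Linear combinations, products and affine substitution *)

Section FormAlgebra.
Variables (R : realType) (E : normedModType R).
Implicit Types (M N : seq E -> R) (G H : E -> seq E -> R) (U : set E).

Lemma mbound_add k M N c d :
  mbound k M c -> mbound k N d -> mbound k (fun s => M s + N s) (c + d).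
Proof.
move=> Mc Nd s sk; apply: le_trans (ler_normD _ _) _.
by rewrite mulrDl lerD ?Mc ?Nd.
Qed.

Lemma mbound_scale k M a c : mbound k M c -> mbound k (fun s => a * M s) (`|a| * c).
Proof. by move=> Mc s sk; rewrite normrM -mulrA ler_wpM2l// Mc. Qed.

Lemma mbound_ext k M N c :
  (forall s, size s = k -> M s = N s) -> mbound k M c -> mbound k N c.
Proof. by move=> MN Mc s sk; rewrite -MN// Mc. Qed.

Lemma mbound_tail k M c h : mbound k.+1 M c -> mbound k (fun s => M (h :: s)) (c * `|h|).
Proof. by move=> Mc s sk; rewrite -mulrA -nprod_cons Mc//= sk. Qed.

Lemma mbound_tens b M N c d : mbound (count id b) M c ->
  mbound (count id (map negb b)) N d ->
  mbound (size b) (fun s => M (mask b s) * N (mask (map negb b) s)) (c * d).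
Proof.
move=> Mc Nd s sb; rewrite normrM (nprod_mask (b := b))// mulrACA.
by apply: ler_pM => //; [apply: Mc|apply: Nd]; rewrite size_mask ?size_map.
Qed.

Lemma form_cont_lin k a G H x : form_cont k G x -> form_cont k H x ->
  form_cont k (fun x s => a * G x s + H x s) x.
Proof.
move=> [lG [c bG] cG] [lH [d bH] cH]; split.
- by move=> s1 s2 t u w sk; rewrite lG// lH//; ring.
- by exists (`|a| * c + d); apply: mbound_add => //; exact: mbound_scale.
move=> e e0; have a0 : 0 < `|a| + 1 by rewrite ltr_wpDl.
have e1 : 0 < e / (`|a| + 1) by rewrite divr_gt0.
apply: filterS2 (cG _ e1) (cH _ e1) => y By Cy.
apply: (@mbound_le _ _ _ _ (`|a| * (e / (`|a| + 1)) + e / (`|a| + 1))).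
  by rewrite -{2}[e / _]mul1r -mulrDl mulrCA divff ?mulr1// gt_eqF.
apply: mbound_ext (mbound_add (mbound_scale a By) Cy) => s sk; ring.
Qed.

Lemma form_deriv_lin k a G H G' H' x : form_deriv k G G' x -> form_deriv k H H' x ->
  form_deriv k (fun x s => a * G x s + H x s) (fun x s => a * G' x s + H' x s) x.
Proof.
move=> dG dH e e0; have a0 : 0 < `|a| + 1 by rewrite ltr_wpDl.
have e1 : 0 < e / (`|a| + 1) by rewrite divr_gt0.
apply: filterS2 (dG _ e1) (dH _ e1) => h Bh Ch.
apply: (@mbound_le _ _ _ _ (`|a| * (e / (`|a| + 1) * `|h|) + e / (`|a| + 1) * `|h|)).
  by rewrite mulrA -mulrDl -{2}[e / _]mul1r -mulrDl mulrCA divff ?mulr1// gt_eqF.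
apply: mbound_ext (mbound_add (mbound_scale a Bh) Ch) => s sk; ring.
Qed.

Lemma CC_lin n U k a G H : CC n U k G -> CC n U k H ->
  CC n U k (fun x s => a * G x s + H x s).
Proof.
elim: n k G H => [|n IH] k G H [cG dG] [cH dH]; split=> //.
- by move=> x Ux; apply: form_cont_lin; [exact: cG|exact: cH].
- by move=> x Ux; apply: form_cont_lin; [exact: cG|exact: cH].
move: dG dH => [G' [dG CG]] [H' [dH CH]].
exists (fun x s => a * G' x s + H' x s); split; last exact: IH.
by move=> x Ux; apply: form_deriv_lin; [exact: dG|exact: dH].
Qed.

Lemma mbound_zero k (e : R) : 0 <= e -> mbound k (fun _ : seq E => 0) e.
Proof. by move=> e0 s _; rewrite normr0 mulr_ge0// nprod_ge0. Qed.

Lemma CC_zero n U k : CC n U k (fun _ _ => 0).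
Proof.
have C x : form_cont k (fun (_ : E) (_ : seq E) => (0 : R)) x.
  split=> [s1 s2 a u w _||e e0]; first by rewrite mulr0 addr0.
    by exists 0; exact: mbound_zero.
  by apply: nearW => y; rewrite subrr; apply: mbound_zero; exact: ltW.
elim: n k C => [|n IH] k C; split => //.
exists (fun _ _ => 0); split => [x _ e e0|]; last first.
  apply: IH => x; split=> [s1 s2 a u w _||e e0]; first by rewrite mulr0 addr0.
    by exists 0; exact: mbound_zero.
  by apply: nearW => y; rewrite subrr; apply: mbound_zero; exact: ltW.
by apply: nearW => h; rewrite !subr0; apply: mbound_zero; rewrite mulr_ge0// ltW.
Qed.

Lemma CC_cst n U (c : R) : CC n U 0 (fun _ _ => c).
Proof.
have C x : form_cont 0 (fun (_ : E) (_ : seq E) => c) x.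
  split=> [s1 s2 a u w /eqP||e e0]; first by rewrite addnS.
    by exists `|c| => s /size0nil->; rewrite /nprod big_nil mulr1.
  by apply: nearW => y; rewrite subrr; apply: mbound_zero; exact: ltW.
case: n => [|n]; split => //; exists (fun _ _ => 0); split; last exact: CC_zero.
move=> x _ e e0; apply: nearW => h; rewrite subrr subr0; apply: mbound_zero.
by rewrite mulr_ge0// ltW.
Qed.

(** [b] records which arguments belong to [G]. Differentiation puts a new first argument into either
    factor, so the arguments of the two factors become interleaved and a plain concatenation would
    not be stable. *)
Definition tens b G H x s := G x (mask b s) * H x (mask (map negb b) s).

Lemma mlin_tens b M N : mlin (count id b) M -> mlin (count id (map negb b)) N ->
  mlin (size b) (fun s => M (mask b s) * N (mask (map negb b) s)).
Proof.
move=> lM lN s1 s2 a u w sb.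
have -> : b = take (size s1) b ++ drop (size s1) b by rewrite cat_take_drop.
have ss1 : size (take (size s1) b) = size s1.
  by rewrite size_take -sb -addn1 leq_add2l.
have ss2 : size (drop (size s1) b) = (size s2).+1.
  by rewrite size_drop -sb addKn.
move: ss1 ss2 lM lN; rewrite -{3 4}(cat_take_drop (size s1) b).
move: (take _ _) (drop _ _) => b1 [//|b0 b2] ss1 [ss2].
rewrite !map_cat !count_cat /= => lM lN; rewrite !mask_cat ?size_map//=.
have sm1 : size (mask b1 s1) = count id b1 by rewrite size_mask.
have sm2 : size (mask b2 s2) = count id b2 by rewrite size_mask.
have sn1 : size (mask (map negb b1) s1) = count id (map negb b1).
  by rewrite size_mask ?size_map.
have sn2 : size (mask (map negb b2) s2) = count id (map negb b2).
  by rewrite size_mask ?size_map.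
case: b0 lM lN => /= lM lN.
  by rewrite lM ?sm1 ?sm2// mulrDl mulrA.
by rewrite lN ?sn1 ?sn2// mulrDr mulrCA.
Qed.

Lemma form_cont_tens b k l G H x : count id b = k -> count id (map negb b) = l ->
  form_cont k G x -> form_cont l H x -> form_cont (size b) (tens b G H) x.
Proof.
move=> <- <- [lG [c /mbound_pos bG] cG] [lH [d /mbound_pos bH] cH]; split.
- exact: mlin_tens.
- by exists (`|c| * `|d|); exact: mbound_tens.
move=> e e0; pose C := `|c| + `|d| + 1.
have C0 : 0 < C by rewrite ltr_wpDl// addr_ge0.
have e1 : 0 < e / C by rewrite divr_gt0.
apply: filterS3 (cG _ e1) (cH _ e1) (cH _ ltr01) => y Gy Hy Hy1.
have {}Hy1 : mbound (count id (map negb b)) (H y) (1 + `|d|).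
  by apply: mbound_ext (mbound_add Hy1 bH) => s _; rewrite subrK.
apply: (@mbound_le _ _ _ _ (e / C * (1 + `|d|) + `|c| * (e / C))).
  by rewrite [`|c| * _]mulrC -mulrDr (_ : _ + _ = C) ?mulfVK ?gt_eqF// /C; ring.
apply: mbound_ext (mbound_add (mbound_tens Gy Hy1) (mbound_tens bG Hy)) => s _.
by rewrite /tens; ring.
Qed.

(** The remainder is split as [(G (x + h) - G x - G' x h) H (x + h) + G' x h (H (x + h) - H x) + G x
    (H (x + h) - H x - H' x h)], and [C] adds up the three bounds. The factor [1] gives the
    derivative the shape required by [CC_lin]. *)
Lemma form_deriv_tens b k l G H G' H' x : count id b = k ->
  count id (map negb b) = l ->
  form_cont k G x -> form_cont l H x -> form_cont k.+1 G' x ->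
  form_deriv k G G' x -> form_deriv l H H' x ->
  form_deriv (size b) (tens b G H)
    (fun x s => 1 * tens (true :: b) G' H x s + tens (false :: b) G H' x s) x.
Proof.
move=> <- <- [_ [c /mbound_pos bG] _] [_ [d /mbound_pos bH] cH].
move=> [_ [c' /mbound_pos bG'] _] dG dH e e0.
pose C := `|d| + 1 + `|c'| + `|c|.
have C0 : 0 < C by rewrite /C -addrA ltr_wpDr ?addr_ge0// ltr_wpDl.
have e1 : 0 < e / C by rewrite divr_gt0.
have B1 := near_add (cH _ e1); have B2 := near_add (cH _ ltr01).
apply: filterS2 (filterI (dG _ e1) (dH _ e1)) (filterI B1 B2) => h [Gh Hh] [Kh K1].
have {}K1 : mbound (count id (map negb b)) (H (x + h)) (1 + `|d|).
  by apply: mbound_ext (mbound_add K1 bH) => s _; rewrite subrK.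
have := mbound_add (mbound_add (mbound_tens Gh K1)
  (mbound_tens (mbound_tail h bG') Kh)) (mbound_tens bG Hh).
have -> : e / C * `|h| * (1 + `|d|) + `|c'| * `|h| * (e / C) + `|c| * (e / C * `|h|)
    = e * `|h| by rewrite /C; field; rewrite gt_eqF.
by apply: mbound_ext => s _; rewrite /tens /=; ring.
Qed.

Lemma CC_tens n U b k l G H : count id b = k -> count id (map negb b) = l ->
  CC n U k G -> CC n U l H -> CC n U (size b) (tens b G H).
Proof.
elim: n b k l G H => [|n IH] b k l G H bk bl CG CH; split=> //.
- by move=> x Ux; apply: (form_cont_tens bk bl); [exact: (CC_cont CG)|exact: (CC_cont CH)].
- by move=> x Ux; apply: (form_cont_tens bk bl); [exact: (CC_cont CG)|exact: (CC_cont CH)].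
have [cG [G' [dG CG']]] := CG; have [cH [H' [dH CH']]] := CH.
exists (fun x s => 1 * tens (true :: b) G' H x s + tens (false :: b) G H' x s).
split=> [x Ux|].
  apply: (form_deriv_tens bk bl (cG x Ux) (cH x Ux)); [|exact: dG|exact: dH].
  exact: CC_cont CG' _ Ux.
apply: CC_lin.
  by apply: (IH (true :: b) k.+1 l) => //=; [rewrite bk|exact: CC_pred].
by apply: (IH (false :: b) k l.+1) => //=; [rewrite bl|exact: CC_pred].
Qed.

Lemma CC_affine n k G (r : R) (a : E) : CC n setT k G ->
  CC n setT k (fun x s => G (r *: (x - a)) s).
Proof.
have C j (K : E -> seq E -> R) x : form_cont j K (r *: (x - a)) ->
    form_cont j (fun x s => K (r *: (x - a)) s) x.
  move=> [l b c]; split => // e e0.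
  have cf : {for x, continuous (fun y : E => r *: (y - a))}.
    by apply: cvgZr; apply: cvgB; [exact: cvg_id|exact: cvg_cst].
  exact: cf _ (c e e0).
elim: n k G => [|n IH] k G /= [c H]; split=> //.
- by move=> x _; apply: C; exact: c.
- by move=> x _; apply: C; exact: c.
move: H => [G' [d CG']].
exists (fun x s => r * G' (r *: (x - a)) s + 0); split=> [x _ e e0|]; last first.
  by apply: CC_lin; [exact: IH|exact: CC_zero].
have r0 : 0 < `|r| + 1 by rewrite ltr_wpDl.
have e1 : 0 < e / (`|r| + 1) by rewrite divr_gt0.
have cf : (fun h : E => r *: h) @ (0 : E) --> (0 : E).
  by rewrite -[X in _ --> X](scaler0 E r); apply: cvgZr; exact: cvg_id.
apply: (@filterS _ (nbhs (0 : E)) _ _ _ _ (cf _ (d (r *: (x - a)) I _ e1))) => h /= Bh.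
apply: (@mbound_le _ _ _ _ (e / (`|r| + 1) * `|r *: h|)).
  rewrite normrZ mulrA ler_wpM2r// mulrAC ler_pdivrMr// ler_pM2l//; lra.
apply: mbound_ext Bh => s sk; have [l _ _] := CC_cont CG' (x := r *: (x - a)) I.
by rewrite (mlin_scale _ _ l)// addr0 -scalerDr [x - a + h]addrAC.
Qed.

End FormAlgebra.

(** * Flat functions of a real variable *)

Section RealFunctions.
Variable R : realType.
Implicit Types (th : R -> R) (t d : R).

(** Written without a quotient, so that vanishing increments need no separate case in the chain
    rule. *)
Definition deriv_at th t d := forall e, 0 < e -> \forall u \near t,
  `|th u - th t - d * (u - t)| <= e * `|u - t|.

Lemma is_derive_deriv_at th t d : is_derive t (1 : R) th d -> deriv_at th t d.
Proof.
move=> [dv <-] e e0.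
have /cvgrPdist_le/(_ e e0) : h^-1 *: ((th \o shift t) (h *: (1 : R)) - th t)
  @[h --> (0 : R)^'] --> 'D_1 th t := dv.
case/nbhs_ballP => r /= r0 Hr; apply/nbhs_ballP; exists r => // u.
rewrite -ball_normE/= distrC => ur.
have [->|ut] := eqVneq u t; first by rewrite !subrr mulr0 subrr normr0 mulr0.
have ut0 : u - t != 0 by rewrite subr_eq0.
have := Hr (u - t); rewrite -ball_normE/= sub0r normrN => /(_ ur ut0).
rewrite /shift /= [_ *: 1]mulr1 subrK => H.
rewrite -ler_pdivrMr ?normr_gt0// -normf_div; apply: le_trans H.
rewrite le_eqVlt; apply/orP; left; apply/eqP; rewrite -normrN.
by congr `|_|; rewrite /GRing.scale/=; field.
Qed.

Lemma deriv_at_continuous th t d : deriv_at th t d -> {for t, continuous th}.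
Proof.
move=> D; apply/cvgrPdist_lt => e e0.
have c0 : 0 < `|d| + 1 by rewrite ltr_wpDl.
have e1 : 0 < e / (`|d| + 1) by rewrite divr_gt0.
have h : \forall u \near t, `|t - u| < e / (`|d| + 1).
  by apply/nbhs_ballP; exists (e / (`|d| + 1)) => // u; rewrite -ball_normE.
apply: filterS2 (D 1 ltr01) h => u; rewrite mul1r => Du.
rewrite ltr_pdivlMr// => tu; rewrite distrC.
rewrite (_ : th u - th t = (th u - th t - d * (u - t)) + d * (u - t)); last by rewrite subrK.
apply: le_lt_trans (ler_normD _ _) _; rewrite normrM.
by apply: le_lt_trans tu; rewrite (distrC t) [leRHS]mulrDr mulr1 addrC [`|d| * _]mulrC lerD2l.
Qed.

(* The derivative of [exp_flat m] is a combination of [exp_flat m.+1] and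
   [exp_flat m.+2]; all of them vanish to infinite order at [0]. *)
Definition exp_flat (m : nat) t := if 0 < t then t^-1 ^+ m * expR (- t^-1) else 0.

Lemma exp_flat_ge0 m t : 0 <= exp_flat m t.
Proof.
rewrite /exp_flat; case: ifP => // t0.
by rewrite mulr_ge0 ?expR_ge0// exprn_ge0// invr_ge0 ltW.
Qed.

Lemma exp_flat_le0 m t : t <= 0 -> exp_flat m t = 0.
Proof. by rewrite /exp_flat leNgt => /negbTE ->. Qed.

Lemma exp_flat_gt0 m t : 0 < t -> 0 < exp_flat m t.
Proof.
by rewrite /exp_flat => t0; rewrite t0 mulr_gt0 ?expR_gt0// exprn_gt0// invr_gt0.
Qed.

(** From $e^s \ge s^{m+2}/(m+2)!$ at $s = 1/t$. A quadratic bound is what gives derivative [0] at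
    [0]. *)
Lemma exp_flat_le_sqr m t : exp_flat m t <= m.+2`!%:R * t ^+ 2.
Proof.
have [t0|t0] := ltP 0 t; last by rewrite exp_flat_le0// mulr_ge0// sqr_ge0.
rewrite /exp_flat t0; set s := t^-1; have s0 : 0 < s by rewrite invr_gt0.
have -> : t = s^-1 by rewrite /s invrK.
have F0 : 0 < m.+2`!%:R :> R by rewrite ltr0n fact_gt0.
have := expR_ge1Dxn m.+1 (ltW s0) => H.
have {}H : s ^+ m.+2 <= m.+2`!%:R * expR s.
  by rewrite mulrC -ler_pdivrMr//; lra.
rewrite expRN ler_pdivrMr ?expR_gt0//.
rewrite (_ : _ * s^-1 ^+ 2 * _ = m.+2`!%:R * expR s / s ^+ 2); last first.
  by rewrite exprVn mulrAC.
by rewrite ler_pdivlMr ?exprn_gt0// -exprD addn2.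
Qed.

Lemma exp_flat_deriv m t :
  deriv_at (exp_flat m) t (- m%:R * exp_flat m.+1 t + exp_flat m.+2 t).
Proof.
have [t0|t0|->] := ltgtP t 0.
- move=> e e0; have : \forall u \near t, u < 0 by exact: lt_nbhsl.
  apply: filterS => u /ltW u0; have tl := ltW t0; rewrite !exp_flat_le0//.
  by rewrite !(mulr0, addr0, mul0r, subr0) normr0 mulr_ge0// ltW.
- have D : is_derive t (1 : R) (fun u => u^-1 ^+ m * expR (- u^-1))
      (- m%:R * exp_flat m.+1 t + exp_flat m.+2 t).
    have D1 : is_derive t (1 : R) (fun u : R => u^-1) (- t ^- 2).
      have := @is_deriveV R id t 1 1 (lt0r_neq0 t0) (is_derive_id _ _).
      by rewrite scaler1.
    have D2 : is_derive t (1 : R) (fun u : R => - u^-1) (t ^- 2).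
      by have := is_deriveN D1; rewrite opprK.
    have D3 := @is_derive1_comp R expR (fun u => - u^-1) t _ _ (is_derive_expR _) D2.
    have D4 := is_deriveX m D1.
    rewrite (_ : (fun u : R => u^-1 ^+ m * expR (- u^-1)) =
      ((fun u : R => u^-1) ^+ m) * (expR \o (fun u : R => - u^-1))).
      apply: is_derive_eq (is_deriveM D4 D3) _.
      rewrite exprfctE /exp_flat t0 /GRing.scale /=.
      have t_neq0 := lt0r_neq0 t0.
      case: m {D4} => [|m]; first by field.
      by rewrite !exprS; field.
    by rewrite exprfctE.
  move=> e e0; have : \forall u \near t, 0 < u by exact: lt_nbhsr.
  apply: filterS2 (is_derive_deriv_at D e0) => u; rewrite /exp_flat t0.
  by move=> H u0; rewrite u0.
- move=> e e0; rewrite !exp_flat_le0// mulr0 add0r.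
  have F0 : 0 < m.+2`!%:R :> R by rewrite ltr0n fact_gt0.
  have d0 : 0 < e / m.+2`!%:R by rewrite divr_gt0.
  apply/nbhs_ballP; exists (e / m.+2`!%:R) => // u; rewrite -ball_normE/= sub0r normrN => ue.
  rewrite mul0r !subr0 ger0_norm ?exp_flat_ge0//.
  apply: le_trans (exp_flat_le_sqr m u) _.
  rewrite -(real_normK (num_real u)) expr2 mulrA ler_wpM2r//.
  by rewrite mulrC -ler_pdivlMr// ltW.
Qed.

Lemma inv_deriv t : t != 0 -> deriv_at (fun u => u^-1) t (- (t^-1 ^+ 2)).
Proof.
move=> t0; apply: is_derive_deriv_at.
have := @is_deriveV R id t 1 1 t0 (is_derive_id _ _).
by rewrite scaler1 exprVn.
Qed.

End RealFunctions.

(** * Composition and smooth cut-offs *)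

Section SmoothFunctions.
Variables (R : realType) (E : normedModType R).
Implicit Types (F G : E -> R) (U : set E).

Definition CF n U F := CC n U 0 (fun x _ => F x).

Lemma form_cont0 F (x : E) : form_cont 0 (fun x _ => F x) x <-> {for x, continuous F}.
Proof.
split=> [[_ _ c]|c]; first apply/cvgrPdist_le => e e0.
  apply: filterS (c e e0) => y /(_ [::] erefl).
  by rewrite /nprod big_nil mulr1 distrC.
split=> [s1 s2 a u w /eqP||e e0]; first by rewrite addnS.
  by exists `|F x| => s /size0nil ->; rewrite /nprod big_nil mulr1.
move/cvgrPdist_le: c => /(_ e e0); apply: filterS => y Hy s /size0nil ->.
by rewrite /nprod big_nil mulr1 distrC.
Qed.

Lemma CF_continuous n U F x : CF n U F -> U x -> {for x, continuous F}.
Proof. by move=> /CC_cont C Ux; apply/form_cont0; exact: C. Qed.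

Lemma CF_mul n U F G : CF n U F -> CF n U G -> CF n U (fun x => F x * G x).
Proof. exact: (@CC_tens _ _ n U [::] 0 0). Qed.

Lemma CF_lin n U a F G : CF n U F -> CF n U G -> CF n U (fun x => a * F x + G x).
Proof. exact: CC_lin. Qed.

Lemma CF_cst n U c : CF n U (fun=> c).
Proof. exact: CC_cst. Qed.

Lemma CF_comp_cont U F (th : R -> R) : CF 0 U F ->
  (forall x, U x -> {for F x, continuous th}) -> CF 0 U (fun x => th (F x)).
Proof.
move=> CFF c; split => // x Ux; apply/form_cont0.
by apply: continuous_comp; [exact: CF_continuous CFF Ux|exact: c].
Qed.

(** Smoothness is asked of the composite of [th'] with [F], so an induction on [n] closes as soon as
    [th'] is expressed by functions of the same family, as for [exp_flat] and the inverse. *)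
Lemma CF_comp n U F (th th' : R -> R) : CF n.+1 U F ->
  (forall x, U x -> deriv_at th (F x) (th' (F x))) ->
  CF n U (fun x => th' (F x)) -> CF n.+1 U (fun x => th (F x)).
Proof.
move=> CFF D Cth'; have [cF [F' [dF CF']]] := CFF; split.
  move=> x Ux; apply/form_cont0; apply: continuous_comp; first exact/form_cont0/cF.
  exact: deriv_at_continuous (D x Ux).
exists (tens [:: false] (fun x _ => th' (F x)) F'); split; last first.
  by apply: (@CC_tens _ _ n U [:: false] 0 1).
move=> x Ux e e0; have [_ [c /mbound_pos bF'] _] := CC_cont CF' Ux.
set d := th' (F x); pose C := `|c| + 1 + `|d|.
have C0 : 0 < C by rewrite /C -addrA ltr_wpDl// ltr_wpDr.
have e1 : 0 < e / C by rewrite divr_gt0.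
have B1 : \forall y \near x, `|th (F y) - th (F x) - d * (F y - F x)| <= e / C * `|F y - F x|.
  have cFx : {for x, continuous F} by exact/form_cont0/cF.
  exact: (cFx _ (D x Ux _ e1)).
apply: filterS3 (near_add B1) (dF x Ux _ e1) (dF x Ux _ ltr01).
move=> h Bh /(_ [::] erefl) + /(_ [::] erefl) + s /size0nil ->.
have := bF' [:: h] erefl; rewrite /tens /= /nprod big_seq1 big_nil !mulr1 mul1r.
set Dl := F (x + h) - F x in Bh *; set l := F' x [:: h] => Bl Be1 B1'.
have Dle : `|Dl| <= (`|c| + 1) * `|h|.
  have := ler_normD (Dl - l) l; rewrite subrK => /le_trans; apply.
  by rewrite mulrDl mul1r addrC lerD.
have -> : th (F (x + h)) - th (F x) - d * l =
    (th (F (x + h)) - th (F x) - d * Dl) + d * (Dl - l) by ring.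
apply: le_trans (ler_normD _ _) _; rewrite normrM.
apply: (@le_trans _ _ (e / C * ((`|c| + 1) * `|h|) + `|d| * (e / C * `|h|))).
  apply: lerD; first by apply: le_trans Bh _; rewrite ler_wpM2l// ltW.
  by rewrite ler_wpM2l.
by rewrite le_eqVlt; apply/orP; left; apply/eqP; rewrite /C; field; rewrite gt_eqF.
Qed.

Lemma CF_exp_flat n U F m : CF n U F -> CF n U (fun x => exp_flat m (F x)).
Proof.
elim: n m => [|n IH] m C.
  apply: CF_comp_cont => // x _; exact: deriv_at_continuous (exp_flat_deriv m _).
apply: (CF_comp (th' := fun t => - m%:R * exp_flat m.+1 t + exp_flat m.+2 t) C).
  by move=> x _; exact: exp_flat_deriv.
exact: (CF_lin (- m%:R) (IH m.+1 (CC_pred C)) (IH m.+2 (CC_pred C))).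
Qed.

Lemma CF_inv n U F : CF n U F -> (forall x, U x -> F x != 0) ->
  CF n U (fun x => (F x)^-1).
Proof.
move=> + F0; elim: n => [|n IH] C.
  by apply: CF_comp_cont => // x /F0/inv_deriv; exact: deriv_at_continuous.
apply: (CF_comp (th := fun t => t^-1) (th' := fun t => - (t^-1 ^+ 2)) C).
  by move=> x /F0; exact: inv_deriv.
have Ci := IH (CC_pred C).
have := CF_lin (-1) (CF_mul Ci Ci) (CF_cst n U 0).
by congr (CF _ _); apply/funext => x; rewrite addr0 mulN1r.
Qed.

(** A bump function is only known to be nonzero at [0]; composing it with a smooth step produces the
    plateau at [1]. The predicate [P] collects all orders, so that one [chi] serves them
    simultaneously, also for [p] infinite. *)
Lemma CF_cutoff (P : nat -> Prop) (phi : E -> R) (r : R) :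
  (forall n, P n -> CF n setT phi) -> P 0%N -> phi 0 != 0 ->
  (forall x, r < `|x| -> phi x = 0) ->
  forall (a : E) (d : R), 0 < d -> exists chi : E -> R,
    [/\ forall n, P n -> CF n setT chi, forall z, 0 <= chi z <= 1,
      \forall z \near a, chi z = 1 & forall z, d <= `|z - a| -> chi z = 0].
Proof.
move=> Cphi P0 phi0 phir a d d0.
(* Rescaling by [la] sends points at distance at least [d] from [a] to norm at least [|r| + 1],
   outside the support of [phi]. *)
pose la := (`|r| + 1) / d.
pose psi z := phi (la *: (z - a)) / phi 0 * (phi (la *: (z - a)) / phi 0).
have Cpsi n : P n -> CF n setT psi.
  move=> /Cphi C; have C1 : CF n setT (fun z => phi (la *: (z - a)) / phi 0).
    by apply: CF_mul; [exact: CC_affine C|exact: CF_cst].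
  exact: CF_mul.
(* [A / (A + B)] is [0] where [psi <= 1/4] and [1] where [psi >= 3/4]; the two ranges of positivity
   overlap, so the denominator never vanishes. *)
pose A z := exp_flat 0 (1 * psi z + - (1 / 4)); pose B z := exp_flat 0 (-1 * psi z + 3 / 4).
have CA n : P n -> CF n setT A.
  by move=> /Cpsi C; apply: CF_exp_flat; apply: CF_lin => //; exact: CF_cst.
have CB n : P n -> CF n setT B.
  by move=> /Cpsi C; apply: CF_exp_flat; apply: CF_lin => //; exact: CF_cst.
have A0 z : 0 <= A z := exp_flat_ge0 _ _.
have B0 z : 0 <= B z := exp_flat_ge0 _ _.
have AB z : 0 < 1 * A z + B z.
  rewrite mul1r; have [h|h] := ltP (1 / 4) (psi z).
    by rewrite ltr_wpDr// exp_flat_gt0//; lra.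
  by rewrite ltr_wpDl// exp_flat_gt0//; lra.
exists (fun z => A z * (1 * A z + B z)^-1); split.
- move=> n Pn; apply: CF_mul; first exact: CA.
  apply: CF_inv; first by apply: CF_lin; [exact: CA|exact: CB].
  by move=> x _; rewrite gt_eqF.
- move=> z; rewrite divr_ge0 ?(ltW (AB z))//= ler_pdivrMr// !mul1r lerDl//.
- have psia : psi a = 1 by rewrite /psi subrr scaler0 divff// mulr1.
  have : \forall z \near a, 3 / 4 < psi z.
    by apply: near_gt; [exact: CF_continuous (Cpsi _ P0) I|rewrite psia; lra].
  apply: filterS => z hz; have -> : B z = 0 by rewrite /B exp_flat_le0//; lra.
  by rewrite addr0 mul1r divff// gt_eqF// exp_flat_gt0//; lra.
move=> z dz; suff psi0 : psi z = 0.
  by rewrite (_ : A z = 0) ?mul0r// /A exp_flat_le0// psi0; lra.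
rewrite /psi phir ?mul0r//.
have la0 : 0 <= la by rewrite divr_ge0 ?(ltW d0)// addr_ge0.
rewrite normrZ ger0_norm//; apply: (@lt_le_trans _ _ (la * d)); last by rewrite ler_wpM2l.
rewrite /la mulfVK ?gt_eqF//; have := ler_norm r; lra.
Qed.

End SmoothFunctions.

(** * Translation between forms on tuples and forms on sequences *)

Section Interface.
Variables (R : realType) (E : normedModType R).
Implicit Types (F : E -> R) (G H : E -> seq E -> R) (U : set E).

Lemma le_pW k m p : (k <= m)%N -> le_p m p -> le_p k p.
Proof. by case: p => //= n km; exact: leq_trans. Qed.

Definition nths k (s : seq E) : 'I_k -> E := fun i => nth 0 s i.
Arguments nths : clear implicits.

Lemma nths_cat k s1 s2 (i : 'I_k) x : nat_of_ord i = size s1 ->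
  nths k (s1 ++ x :: s2) = upd (nths k (s1 ++ 0 :: s2)) i x.
Proof.
move=> is1; apply/funext => j; rewrite /upd /nths !nth_cat.
have [->|ji] := eqVneq j i; first by rewrite is1 ltnn subnn.
case: ltnP => // sj; case e : (j - size s1)%N => //=.
by case/eqP: ji; apply: val_inj => /=; rewrite is1; apply/eqP;
  rewrite eqn_leq sj andbT -subn_eq0 e.
Qed.

Lemma mlin_nths k (M : ('I_k -> E) -> R) : multilinear M -> mlin k (M \o nths k).
Proof.
move=> l s1 s2 a u w sk; have ik : (size s1 < k)%N by rewrite -sk addnS ltnS leq_addr.
have e x := @nths_cat k s1 s2 (Ordinal ik) x erefl.
rewrite /= (e (a *: u + w)) (e u) (e w); exact: l.
Qed.

Lemma mbound_nths k (M : ('I_k -> E) -> R) c : mlbound M c -> mbound k (M \o nths k) c.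
Proof.
move=> b s sk; apply: le_trans (b _) _.
by rewrite /nprod (big_nth 0) sk big_mkord.
Qed.

Lemma consv_nths k h s : consv h (nths k s) = nths k.+1 (h :: s).
Proof.
apply/funext => i; rewrite /consv /nths; case: unliftP => [j ->|->] //=.
Qed.

Definition tabl k (v : 'I_k -> E) := [seq v i | i <- enum 'I_k].

Lemma size_tabl k (v : 'I_k -> E) : size (tabl v) = k.
Proof. by rewrite size_map size_enum_ord. Qed.

Lemma nprod_tabl k (v : 'I_k -> E) : nprod (tabl v) = \prod_(i < k) `|v i|.
Proof. by rewrite /nprod big_map big_enum. Qed.

Lemma tabl_upd k (v : 'I_k -> E) i : exists s1 s2,
  (size s1 + (size s2).+1 = k)%N /\ forall z, tabl (upd v i z) = s1 ++ z :: s2.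
Proof.
have := mem_enum 'I_k i; rewrite inE; case/splitPr e : (enum _) / => [t d].
have sk : size (enum 'I_k) = k by rewrite size_enum_ord.
have := enum_uniq 'I_k; rewrite e cat_uniq /= => /and3P[_ /norP[it _] /andP[id _]].
exists (map v t), (map v d); split.
  by rewrite !size_map -[RHS]sk e size_cat.
move=> z; rewrite /tabl e map_cat /= {2}/upd eqxx; congr (_ ++ _ :: _).
  by apply/eq_in_map => j jt; rewrite /upd; case: eqVneq => // ji; rewrite -ji jt in it.
by apply/eq_in_map => j jt; rewrite /upd; case: eqVneq => // ji; rewrite -ji jt in id.
Qed.

Lemma multilinear_tabl k (M : seq E -> R) :
  mlin k M -> multilinear (fun v : 'I_k -> E => M (tabl v)).
Proof.
move=> l v i a u w; have [s1 [s2 [sk e]]] := tabl_upd v i.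
by rewrite !e l.
Qed.

Lemma mlbound_tabl k (M : seq E -> R) c : mbound k M c ->
  mlbound (fun v : 'I_k -> E => M (tabl v)) c.
Proof. by move=> b v; rewrite -nprod_tabl; apply: b; rewrite size_tabl. Qed.

Lemma tabl_consv k h (v : 'I_k -> E) : tabl (consv h v) = h :: tabl v.
Proof.
rewrite /tabl enum_ordSl /= {1}/consv unlift_none; congr (_ :: _).
by rewrite -map_comp; apply: eq_map => i /=; rewrite /consv liftK.
Qed.

Lemma Cp_on_CF p U F n : open U -> Cp_on p U F -> le_p n p -> CF n U F.
Proof.
move=> Uo [D [D0 Dml Dd Dc]].
pose G j x := D j x \o nths j.
have cG k x : le_p k p -> U x -> form_cont k (G k) x.
  move=> kp Ux; have [l [c b]] := Dml k kp x Ux; split.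
  - exact: mlin_nths.
  - by exists c; exact: mbound_nths.
  - by move=> e e0; apply: filterS (Dc k kp x Ux e e0) => y; exact: mbound_nths.
have CG m k : le_p (m + k) p -> CC m U k (G k).
  elim: m k => [|m IH] k mk; split=> //.
  - by move=> x Ux; exact: cG.
  - by move=> x Ux; apply: cG => //; apply: le_pW mk; rewrite leq_addl.
  exists (G k.+1); split; last by apply: IH; rewrite -addSnnS.
  have kp : le_p k.+1 p by apply: le_pW mk; rewrite addSn ltnS leq_addl.
  move=> x Ux e e0; apply: filterS (Dd k kp x Ux e e0) => h /mbound_nths.
  by apply: mbound_ext => s sk; rewrite /G /= consv_nths.
move=> np; have : CC n U 0 (G 0%N) by apply: CG; rewrite addn0.
by apply: CC_eq => // x Ux s _; rewrite /G /= D0.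
Qed.

(** For [p] infinite the hypothesis gives a separate tower for each order, while one common tower is
    wanted. By uniqueness the derivative taken from order [1] agrees on [U] with those of all higher
    orders, so it inherits their smoothness and the tower can be continued. *)
Lemma CF_Cp_on p U F : open U -> (forall n, le_p n p -> CF n U F) -> Cp_on p U F.
Proof.
move=> Uo CFF.
pose P k G := forall n, le_p (n + k) p -> CC n U k G.
have step k G : le_p k.+1 p -> P k G ->
    exists G', (forall x, U x -> form_deriv k G G' x) /\ P k.+1 G'.
  move=> kp PG; have [_ [G' [dG CG']]] := PG 1%N kp; exists G'; split => // n nk.
  have [|_ [G2 [dG2 CG2]]] := PG n.+1; first by rewrite addSnnS.
  apply: (CC_eq Uo _ CG2) => x Ux s sk.
  have [l1 _ _] := CG'.1 x Ux; have [l2 _ _] := CC_cont (CG2 : CC n U k.+1 G2) Ux.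
  exact: (form_deriv_uniq l2 l1 (dG2 x Ux) (dG x Ux)).
have [nx Hnx] : {nx : nat * (E -> seq E -> R) -> E -> seq E -> R & forall kG,
    le_p kG.1.+1 p -> P kG.1 kG.2 ->
    (forall x, U x -> form_deriv kG.1 kG.2 (nx kG) x) /\ P kG.1.+1 (nx kG)}.
  apply: (@choice _ _ (fun kG G' => le_p kG.1.+1 p -> P kG.1 kG.2 ->
    (forall x, U x -> form_deriv kG.1 kG.2 G' x) /\ P kG.1.+1 G')) => -[k G].
  have [[kp PG]|H] := pselect (le_p k.+1 p /\ P k G).
    by have [G' HG'] := step k G kp PG; exists G'.
  by exists G => kp PG; exfalso; apply: H.
pose D := fix D k := if k is k'.+1 then nx (k', D k') else (fun x (_ : seq E) => F x).
have PD k : le_p k p -> P k (D k).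
  elim: k => [|k IH] kp; first by move=> n; rewrite addn0; exact: CFF.
  by have [] := Hnx (k, D k) kp (IH (le_pW (leqnSn k) kp)).
exists (fun k x v => D k x (tabl v)); split=> //.
- move=> k kp x Ux; have [l [c b] _] := CC_cont (PD k kp 0%N kp) Ux.
  by split; [exact: multilinear_tabl|exists c; exact: mlbound_tabl].
- move=> k kp x Ux e e0; have [d _] := Hnx (k, D k) kp (PD k (le_pW (leqnSn k) kp)).
  apply: filterS (d x Ux e e0) => h /mlbound_tabl b v.
  by rewrite tabl_consv; exact: b.
- move=> k kp x Ux e e0; have [_ _ c] := CC_cont (PD k kp 0%N kp) Ux.
  by apply: filterS (c e e0) => y; exact: mlbound_tabl.
Qed.

End Interface.

(** * The spaces $C^p(X)$ and $C^p_b(X)$ *)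

Section SmoothSpaces.
Variables (R : realType) (X : metricType R) (p : option nat) (E : normedModType R).
Variables (U : set E) (iota : X -> E).
Hypotheses (Uo : open U) (iota_inj : injective iota) (iotaU : range iota = U).
Hypothesis iota_isom : forall x y, mdist x y = `|iota x - iota y|.
Hypothesis bump : supports_Cp_bump E p.

Let Cp := [set f : X -> R | exists F : E -> R,
  (forall x, F (iota x) = f x) /\ Cp_on p U F].

Let Cp_CF f : Cp f <-> exists F : E -> R,
  (forall x, F (iota x) = f x) /\ forall n, le_p n p -> CF n U F.
Proof.
split=> -[F [Ff CFF]]; exists F; split => //.
  by move=> n; exact: Cp_on_CF.
exact: CF_Cp_on.
Qed.

Let Uiota x : U (iota x). Proof. by rewrite -iotaU; exists x. Qed.

Lemma iota_continuous : continuous iota.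
Proof.
move=> x; apply/cvgrPdist_lt => e e0; apply/nbhs_ballP; exists e => // y.
by rewrite ballEmdist /= iota_isom.
Qed.

Let Cp_lin a f g : Cp f -> Cp g -> Cp (fun x => a * f x + g x).
Proof.
move=> /Cp_CF[F [Ff CFF]] /Cp_CF[G [Gg CG]]; apply/Cp_CF.
exists (fun z => a * F z + G z); split=> [x|n np]; first by rewrite Ff Gg.
by apply: CF_lin; [exact: CFF|exact: CG].
Qed.

Let Cp_mul f g : Cp f -> Cp g -> Cp (fun x => f x * g x).
Proof.
move=> /Cp_CF[F [Ff CFF]] /Cp_CF[G [Gg CG]]; apply/Cp_CF.
exists (fun z => F z * G z); split=> [x|n np]; first by rewrite Ff Gg.
by apply: CF_mul; [exact: CFF|exact: CG].
Qed.

Let Cp_cst c : Cp (fun=> c).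
Proof. by apply/Cp_CF; exists (fun=> c); split => // n _; exact: CF_cst. Qed.

Let Cp_cont f : Cp f -> continuous f.
Proof.
move=> /Cp_CF[F [Ff CFF]] x.
have C0 : CF 0 U F by apply: CFF; case: p.
rewrite (_ : f = F \o iota); last by apply/funext => z; rewrite /= Ff.
apply: continuous_comp; first exact: iota_continuous.
exact: CF_continuous C0 (Uiota x).
Qed.

Let Cp_loc f : locA Cp f -> Cp f.
Proof.
move=> lf; apply/Cp_CF.
have [F HF] : {F : E -> R & forall e x, iota x = e -> F e = f x}.
  apply: (@choice _ _ (fun e r => forall x, iota x = e -> r = f x)) => e.
  have [[x xe]|ne] := pselect (exists x, iota x = e).
    by exists (f x) => y; rewrite -xe => /iota_inj ->.
  by exists 0 => x xe; exfalso; apply: ne; exists x.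
exists F; split=> [x|n np]; first exact: HF.
apply: CC_glue => e; rewrite -{1}iotaU => -[x _ <-].
have [V [/nbhs_ballP[r /= r0 rV] [g [/Cp_CF[G [Gg CG]] fg]]]] := lf x.
have Wo : open (ball (iota x) r `&` U) by apply: openI => //; exact: ball_open.
have WU : ball (iota x) r `&` U `<=` U by exact: subIsetr.
have Wx : (ball (iota x) r `&` U) (iota x) by split; [exact: ballxx|exact: Uiota].
exists (ball (iota x) r `&` U); split; [exact: Wo|exact: WU|exact: Wx|].
apply: (CC_eq (G := fun z _ => G z) Wo _ (CC_sub WU (CG n np))).
move=> z [+ +] s _; rewrite -{1}iotaU => + [y _ yz]; rewrite -yz => xy.
rewrite (HF _ y erefl) Gg -fg//; apply: rV; rewrite ballEmdist/= iota_isom.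
by move: xy; rewrite -ball_normE.
Qed.

Let Cp_cut : cuttable Cp.
Proof.
move=> f x V Cf f0 /nbhs_ballP[d /= d0 dV].
have [phi [phiC phi0 [r phir]]] := bump.
have Cphi n : le_p n p -> CF n setT phi by exact: Cp_on_CF openT phiC.
have [|chi [Cchi chi01 chi1 chi0]] := CF_cutoff Cphi _ phi0 phir (iota x) d0.
  by case: p.
exists (fun z => f z * chi (iota z)); split.
- apply: Cp_mul => //; apply/Cp_CF; exists chi; split => // n np.
  by apply: (CC_sub (U := setT)); [exact: subsetT|exact: Cchi].
- move=> z; have /andP[c0 c1] := chi01 (iota z).
  by rewrite mulr_ge0//= -[leRHS]mulr1 ler_wpM2l.
- have chix : \forall z \near x, chi (iota z) = 1 by exact: (iota_continuous chi1).
  by apply: filterS chix => z ->; rewrite mulr1.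
- move=> z Vz; rewrite chi0 ?mulr0// distrC -iota_isom leNgt.
  by apply/negP => xz; apply: Vz; apply: dV; rewrite ballEmdist.
Qed.

Lemma smooth_good A : A = Cp \/ A = bpart Cp -> good A.
Proof.
move=> HA.
(* The proposition [b] tells whether boundedness is demanded, so both spaces are handled at once. *)
have [b AP] : exists b : Prop, forall f, A f <-> Cp f /\ (b -> Defs.bounded_fun f).
  case: HA => ->; first by exists False => f; split=> [|[]].
  exists True => f; split=> -[Cf Bf]; first by split.
  by split; last exact: Bf.
have Adom v w : Cp v -> A w -> (forall z, 0 <= v z <= w z) -> A v.
  move=> Cv /AP[Cw Bw] vw; apply/AP; split => // /Bw Bw'.
  exact: (bpart_dominated (A := setT) (conj I Bw') vw).
have Acst c : A (fun=> c) by apply/AP; split; [exact: Cp_cst|exists `|c|].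
have Alin : lin_closed A.
  move=> a f g /AP[Cf Bf] /AP[Cg Bg]; apply/AP; split; first exact: Cp_lin.
  move=> bb; have [M HM] := Bf bb; have [N HN] := Bg bb.
  exists (`|a| * M + N) => x; apply: le_trans (ler_normD _ _) _.
  by rewrite normrM lerD ?ler_wpM2l.
have Acut : cuttable A.
  move=> f x V Af f0 nV; have [v [Cv v0 vx vV]] := Cp_cut ((AP f).1 Af).1 f0 nV.
  by exists v; split => //; exact: Adom Cv Af v0.
split => //.
- by move=> f /AP[/Cp_cont].
- apply: local_oscillating => // v w lv Aw vw; apply: (Adom _ _ _ Aw vw).
  apply: Cp_loc => x; have [V [nV [g [Ag vg]]]] := lv x; exists V; split => //.
  by exists g; split => //; case/AP: Ag.
- move=> f Af; have [Cf Bf] := (AP f).1 Af.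
  have Ag : A (fun x => 1 * (f x * f x) + 1).
    apply: Alin => //; apply/AP; split; first exact: Cp_mul.
    move=> /Bf[M HM]; exists (M * M) => x; rewrite normrM.
    by apply: ler_pM.
  (* [f = (f^2 + 1) - (f^2 - f + 1)], where both terms are positive, smooth, and bounded if [f]
     is. *)
  exists (fun x => 1 * (f x * f x) + 1), (fun x => -1 * f x + (1 * (f x * f x) + 1)).
  split => //; first exact: Alin.
  + by move=> x; rewrite mul1r addr_ge0// -expr2 sqr_ge0.
  + move=> x; have := sqr_ge0 (f x - 1 / 2); rewrite expr2; nra.
  + by apply/funext => x; ring.
Qed.

End SmoothSpaces.

Lemma admissible_good (R : realType) (X : metricType R) (A : set (X -> R)) :
  admissible A -> good A.
Proof.
case=> [[[lA sA cA] H]|]; first exact: lattice_good.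
move=> [p [E [U [iota [Uo [iota_inj iotaU] isom bump HA]]]]].
exact: smooth_good Uo iota_inj iotaU isom bump _ HA.
Qed.

Theorem theorem4p5 (R : realType) (X Y : metricType R)
    (A : set (X -> R)) (B : set (Y -> R))
    (T : (X -> R) -> (Y -> R)) (S : (Y -> R) -> (X -> R)) :
  admissible A -> admissible B -> linear_order_iso A B T S ->
  exists (h : X -> Y) (hinv : Y -> X),
    [/\ cancel h hinv /\ cancel hinv h, continuous h, continuous hinv,
        (forall f, A f -> T f = (fun y => T (fun _ => 1) y * f (hinv y)))
      & (forall g, B g -> S g = (fun x => S (fun _ => 1) x * g (h x)))].
Proof.
move=> /admissible_good gA /admissible_good gB; exact: good_iso_homeo.
Qed.
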